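(* Let $n \geq 2$. Suppose that the Kakeya maximal function conjecture holds in $\mathbb{R}^{n}$, i.e. for every $\epsilon > 0$ there is a constant $C(\epsilon)$ such that $$\|M_{\delta}f\|_{L^{n}(S^{n-1})} \leq C(\epsilon)\, \delta^{-\epsilon}\, \|f\|_{L^{n}(\mathbb{R}^{n})}$$ for all $0 < \delta < 1$ and all $f \in L^{n}(\mathbb{R}^{n})$. Then every Kakeya set $K \subset \mathbb{R}^{n}$ has conformal dimension equal to $n$.
   Context: For $e \in S^{n-1}$ and $x \in \mathbb{R}^{n}$, write $L_{e}(x) = \{x + te : 0 \leq t \leq 1\}$, and for $\delta > 0$ let $T_{e}^{\delta}(x)$ be the closed $\delta$-neighbourhood of $L_{e}(x)$ in $\mathbb{R}^{n}$. For a locally integrable function $f$ on $\mathbb{R}^{n}$, the Kakeya maximal function $M_{\delta}f \colon S^{n-1} \to [0,\infty]$ is $$(M_{\delta}f)(e) := \sup_{x \in \mathbb{R}^{n}} \frac{1}{|T_{e}^{\delta}(x)|} \int_{T_{e}^{\delta}(x)} |f(y)| \, dy,$$ where $|\cdot|$ is Lebesgue measure. The sphere $S^{n-1}$ is equipped with $(n-1)$-dimensional Hausdorff (outer) measure $\mathcal{H}^{n-1}$. A set $K \subset \mathbb{R}^{n}$, $n \geq 2$, is called a Kakeya set if there exists a set $S \subset S^{n-1}$ of positive $\mathcal{H}^{n-1}$-measure such that for every $e \in S$ the set $K$ contains a unit line segment of the form $L_{e}(x)$ for some $x \in \mathbb{R}^{n}$. A homeomorphism $g$ from a metric space $(X,d)$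 onto a metric space $(Y,d')$ is quasisymmetric if there exists an increasing homeomorphism $\eta \colon [0,\infty) \to [0,\infty)$ such that $$\frac{d'(g(x),g(y))}{d'(g(x),g(z))} \leq \eta\left(\frac{d(x,y)}{d(x,z)}\right)$$ for all $x,y,z \in X$ with $x \neq z$. The conformal dimension of a metric space $X$ is the infimum of the Hausdorff dimensions $\dim_{\mathrm{H}} g(X)$ over all quasisymmetric homeomorphisms $g$ from $X$ onto arbitrary metric spaces. The set $K$ carries the Euclidean metric. *)

(* Defs.v *)
From HB Require Import structures.
From mathcomp Require Import all_boot all_order all_algebra.
From mathcomp Require Import all_classical all_reals all_analysis.
From mathcomp Require Import ring.

Set Implicit Arguments.
Unset Strict Implicit.
Unset Printing Implicit Defensive.
Import Order.TTheory GRing.Theory Num.Theory.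
Import numFieldNormedType.Exports.

Local Open Scope classical_set_scope.
Local Open Scope ring_scope.

(* An alias of ['rV[R]_n], whose library norm and topology come from the sup
   norm; the alias carries the Euclidean metric instead. *)
Definition euclid (R : realType) (n : nat) : Type := 'rV[R]_n.

HB.instance Definition _ (R : realType) (n : nat) :=
  GRing.Lmodule.copy (euclid R n) 'rV[R]_n.
HB.instance Definition _ (R : realType) (n : nat) :=
  Pointed.copy (euclid R n) 'rV[R]_n.

Section euclidean_metric.
Context {R : realType} {n : nat}.
Implicit Types x y z : euclid R n.

Definition coord x (i : 'I_n) : R := (x : 'rV[R]_n) ord0 i.

Definition enorm x : R := Num.sqrt (\sum_(i < n) coord x i ^+ 2).

Definition eucl_dist x y : R := enorm (x - y).

Lemma enorm_ge0 x : 0 <= enorm x.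
Proof. exact: sqrtr_ge0. Qed.

Lemma enorm_sqr x : enorm x ^+ 2 = \sum_(i < n) coord x i ^+ 2.
Proof. by rewrite sqr_sqrtr// sumr_ge0// => i _; rewrite sqr_ge0. Qed.

Lemma coordD x y i : coord (x + y) i = coord x i + coord y i.
Proof. by rewrite /coord [LHS]mxE. Qed.

Lemma coordN x i : coord (- x) i = - coord x i.
Proof. by rewrite /coord [LHS]mxE. Qed.

Lemma coord0 i : coord 0 i = 0.
Proof. by rewrite /coord [LHS]mxE. Qed.

Lemma enorm0_eq0 x : enorm x = 0 -> x = 0.
Proof.
move=> x0; have := enorm_sqr x; rewrite x0 expr0n/= => /esym/eqP.
rewrite psumr_eq0; last by move=> i _; rewrite sqr_ge0.
move=> /allP xi0; apply/rowP => i.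
have := xi0 i (mem_index_enum i); rewrite /= sqrf_eq0 => /eqP.
by rewrite -[RHS](coord0 i).
Qed.

Lemma enorm0 : enorm 0 = 0.
Proof.
by rewrite /enorm big1 ?sqrtr0// => i _; rewrite coord0 expr0n.
Qed.

Lemma enormN x : enorm (- x) = enorm x.
Proof.
by rewrite /enorm; congr Num.sqrt; apply: eq_bigr => i _; rewrite coordN sqrrN.
Qed.

Lemma enorm_cauchy_schwarz x y :
  \sum_(i < n) coord x i * coord y i <= enorm x * enorm y.
Proof.
have [/eqP|x0] := boolP (enorm x == 0).
  move=> x0; rewrite x0 mul0r (enorm0_eq0 x0) big1// => i _.
  by rewrite coord0 mul0r.
have [/eqP|y0] := boolP (enorm y == 0).
  move=> y0; rewrite y0 mulr0 (enorm0_eq0 y0) big1// => i _.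
  by rewrite coord0 mulr0.
set a := enorm x; set b := enorm y.
have ab0 : 0 < a * b by rewrite mulr_gt0// lt0r ?x0 ?y0 enorm_ge0.
have : 0 <= \sum_(i < n) (b * coord x i - a * coord y i) ^+ 2.
  by rewrite sumr_ge0// => i _; rewrite sqr_ge0.
set s := \sum_(i < n) coord x i * coord y i.
have -> : \sum_(i < n) (b * coord x i - a * coord y i) ^+ 2 =
    (a * b) * ((a * b - s) *+ 2).
  transitivity (b ^+ 2 * \sum_(i < n) coord x i ^+ 2 - (a * b * s) *+ 2 +
      a ^+ 2 * \sum_(i < n) coord y i ^+ 2).
    rewrite /s !mulr_sumr -sumrMnl -sumrB -big_split/=.
    by apply: eq_bigr => i _; ring.
  by rewrite -!enorm_sqr -/a -/b; ring.
by rewrite pmulr_rge0// pmulrn_lge0// subr_ge0.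
Qed.

Lemma enormD x y : enorm (x + y) <= enorm x + enorm y.
Proof.
rewrite -(@ler_pXn2r _ 2)// ?nnegrE ?addr_ge0 ?enorm_ge0//.
rewrite sqrrD !enorm_sqr.
under eq_bigr do rewrite coordD sqrrD.
rewrite big_split/= big_split/= lerD2r lerD2l sumrMnl ler_wMn2r//.
exact: enorm_cauchy_schwarz.
Qed.

Lemma eucl_distxx x : eucl_dist x x = 0.
Proof. by rewrite /eucl_dist subrr enorm0. Qed.

Lemma eucl_dist_positivity x y : eucl_dist x y = 0 -> x = y.
Proof. by move/enorm0_eq0/eqP; rewrite subr_eq0 => /eqP. Qed.

Lemma eucl_dist_sym x y : eucl_dist x y = eucl_dist y x.
Proof. by rewrite /eucl_dist -enormN opprB. Qed.

Lemma eucl_dist_triangle y x z : eucl_dist x z <= eucl_dist x y + eucl_dist y z.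
Proof. by rewrite /eucl_dist -(subrKA y) enormD. Qed.

End euclidean_metric.

HB.instance Definition _ (R : realType) (n : nat) :=
  isMetric.Build R (euclid R n) eucl_distxx eucl_dist_positivity eucl_dist_sym
    eucl_dist_triangle.

Section subspace_metric.
Context {R : realType} {X : metricType R} (A : set X).

Let sdist (x y : A) : R := mdist (val x) (val y).

Let sdist_ge0 x y : 0 <= sdist x y.
Proof. exact: mdist_ge0. Qed.

Let sdist_positivity x y : sdist x y = 0 -> x = y.
Proof. by move/mdist_positivity/val_inj. Qed.

Let ballEsdist (x : A) d : ball x d = [set y | sdist x y < d].
Proof. by rewrite -initial_ballE ballEmdist. Qed.

HB.instance Definition _ := @PseudoMetric_isMetric.Build R (A : Type) sdist
  sdist_ge0 sdist_positivity ballEsdist.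

End subspace_metric.

Section cover_outer.
Context {R : realType} {T : Type} {I : choiceType}.
Variables (C : set I) (U : I -> set T) (c : I -> \bar R).
Local Open Scope ereal_scope.

(* Infimum of the total cost of the countable covers of [A] by sets [U i] with
   [C i]; the index set [D] of a cover may be finite or empty. *)
Definition cover_outer (A : set T) : \bar R :=
  ereal_inf [set \esum_(i in D) c i | D in [set D : set I |
    [/\ countable D, D `<=` C & A `<=` \bigcup_(i in D) U i]]].

Hypothesis c_ge0 : forall i, C i -> 0 <= c i.

Lemma cover_outer_ge0 A : 0 <= cover_outer A.
Proof.
apply: le_ereal_inf_tmp => _ [D [_ DC _] <-].
by apply: esum_ge0 => i /DC; exact: c_ge0.
Qed.

Lemma cover_outer0 : cover_outer set0 = 0.
Proof.
apply/eqP; rewrite eq_le cover_outer_ge0 andbT.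
by apply: ereal_inf_lbound; exists set0; rewrite ?esum_set0//; split.
Qed.

Lemma le_cover_outer : {homo cover_outer : A B / A `<=` B >-> A <= B}.
Proof.
move=> A B AB; apply: ereal_inf_le_tmp => _ [D [cD DC BD] <-].
by exists D => //; split => //; exact: subset_trans BD.
Qed.

Lemma cover_outer_sigma_subadditive : sigma_subadditive cover_outer.
Proof.
move=> A; have [[i ioo]|] := pselect (exists i, cover_outer (A i) = +oo).
  rewrite (eseries_pinfty _ _ ioo) ?leey// => k _.
  by rewrite -ltNye (lt_le_trans _ (cover_outer_ge0 _)).
rewrite -forallNE => Aoo.
suff add2e (e : {posnum R}) : cover_outer (\bigcup_n A n) <=
    \sum_(i <oo) cover_outer (A i) + e%:num%:E.
  by apply/lee_addgt0Pr => _/posnumP[].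
rewrite (le_trans _ (epsilon_trick _ _ _))//; last first.
  by move=> k; exact: cover_outer_ge0.
pose P n (D : set I) :=
  [/\ countable D, D `<=` C & A n `<=` \bigcup_(i in D) U i] /\
  \esum_(i in D) c i <= cover_outer (A n) + (e%:num / (2 ^ n.+1)%:R)%:E.
have [D PD] : {D : (set I)^nat & forall n, P n (D n)}.
  apply: (@choice _ _ P) => n.
  have e2 : (0 < e%:num / (2 ^ n.+1)%:R)%R by [].
  have fA : cover_outer (A n) \is a fin_num.
    by rewrite ge0_fin_numE ?cover_outer_ge0// ltey; apply/eqP/Aoo.
  have [_ [D HD <-] /ltW lD] := lb_ereal_inf_adherent e2 fA.
  by exists D.
pose c' i := if i \in C then c i else 0.
have c'_ge0 i : 0 <= c' i by rewrite /c'; case: ifPn => // /set_mem /c_ge0.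
have cE (E : set I) : E `<=` C -> \esum_(i in E) c i = \esum_(i in E) c' i.
  by move=> EC; apply: eq_esum => i /EC /mem_set; rewrite /c' => ->.
have UC : \bigcup_n D n `<=` C by move=> i [n _]; have [[_ + _] _] := PD n; exact.
apply: (@le_trans _ _ (\esum_(i in \bigcup_n D n) c i)).
  apply: ereal_inf_lbound; exists (\bigcup_n D n) => //; split => //.
    by apply: bigcup_countable => // n _; have [[]] := PD n.
  move=> t [n _ Ant]; have [[_ _ /(_ _ Ant) [i Di Uit]] _] := PD n.
  by exists i => //; exists n.
rewrite cE// seqDU_bigcup_eq esum_bigcupT//.
rewrite -nneseries_esumT; last by move=> n; exact: esum_ge0.
apply: lee_nneseries => [n _ _|n _]; first exact: esum_ge0.
have [[_ DC _]] := PD n; rewrite cE//; apply: le_trans.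
rewrite [leRHS](esumID (seqDU D n))//.
rewrite (_ : D n `&` seqDU D n = seqDU D n).
  by rewrite leeDl// esum_ge0.
by apply/setIidPr; exact: subset_seqDU.
Qed.

End cover_outer.

Section lebesgue_measure_on_euclid.
Context {R : realType} {n : nat}.

Definition box (ab : euclid R n * euclid R n) : set (euclid R n) :=
  [set x | forall i, coord ab.1 i <= coord x i <= coord ab.2 i].

Definition ordered_box : set (euclid R n * euclid R n) :=
  [set ab | forall i, coord ab.1 i <= coord ab.2 i].

Definition box_volume (ab : euclid R n * euclid R n) : \bar R :=
  (\prod_(i < n) (coord ab.2 i - coord ab.1 i))%:E.

Definition lebesgue_outer : set (euclid R n) -> \bar R :=
  cover_outer ordered_box box box_volume.

Let box_volume_ge0 ab : ordered_box ab -> (0 <= box_volume ab)%E.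
Proof.
by move=> oab; rewrite lee_fin; apply: prodr_ge0 => i _; rewrite subr_ge0.
Qed.

HB.instance Definition _ := isOuterMeasure.Build R (euclid R n) lebesgue_outer
  (cover_outer0 _ box_volume_ge0)
  (cover_outer_ge0 _ box_volume_ge0)
  (@le_cover_outer _ _ _ _ _ _)
  (cover_outer_sigma_subadditive _ box_volume_ge0).

End lebesgue_measure_on_euclid.

Definition lebesgue_outer_measure (R : realType) (n : nat) :
  {outer_measure set (euclid R n) -> \bar R} := @lebesgue_outer R n.

(* The points of [R^n] with the Lebesgue (Caratheodory) sigma-algebra. *)
Definition lebesgueT (R : realType) (n : nat) :=
  caratheodory_type (lebesgue_outer_measure R n).

Definition lebesgue (R : realType) (n : nat) :
    {measure set (lebesgueT R n) -> \bar R} :=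
  lebesgue_outer_measure R n : set (lebesgueT R n) -> \bar R.

Section hausdorff.
Context {R : realType} {T : metricType R}.
Local Open Scope ereal_scope.

(* [diameter set0 = -oo]; this is harmless below, as a cover may leave the empty
   set out. *)
Definition diameter (U : set T) : \bar R :=
  ereal_sup [set (mdist x y)%:E | x in U & y in U].

(* With [0 `^ 0 = 1] the case [s = 0] gives the counting measure. *)
Definition hausdorff_content (s d : R) : set T -> \bar R :=
  cover_outer [set U | diameter U <= d%:E] id (fun U => diameter U `^ s).

Definition hausdorff_outer (s : R) (A : set T) : \bar R :=
  ereal_sup [set hausdorff_content s d A | d in [set d | (0 < d)%R]].

Definition hausdorff_dim (A : set T) : \bar R :=
  ereal_inf [set s%:E | s in [set s | (0 <= s)%R /\ hausdorff_outer s A = 0]].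

Variable s : R.

Let cost_ge0 (d : R) (U : set T) :
  [set U : set T | diameter U <= d%:E] U -> 0 <= diameter U `^ s.
Proof. by move=> _; exact: poweR_ge0. Qed.

Lemma hausdorff_outer0 : hausdorff_outer s set0 = 0.
Proof.
rewrite /hausdorff_outer (_ : [set _ | _ in _] = [set 0]) ?ereal_sup1//.
apply/seteqP; split => [_ [d _ <-]|_ ->] /=.
  by rewrite /hausdorff_content (cover_outer0 id (@cost_ge0 d)).
by exists 1%R => //; rewrite /hausdorff_content (cover_outer0 id (@cost_ge0 1%R)).
Qed.

Lemma hausdorff_outer_ge0 A : 0 <= hausdorff_outer s A.
Proof.
apply: le_trans (cover_outer_ge0 id (@cost_ge0 1%R) A) _.
by apply: ereal_sup_ubound; exists 1%R => /=.
Qed.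

Lemma le_hausdorff_outer :
  {homo hausdorff_outer s : A B / A `<=` B >-> A <= B}.
Proof.
move=> A B AB; apply: ge_ereal_sup => _ [d d0 <-].
apply: (@le_trans _ _ (hausdorff_content s d B)); first exact: le_cover_outer.
by apply: ereal_sup_ubound; exists d.
Qed.

Lemma hausdorff_outer_sigma_subadditive :
  sigma_subadditive (hausdorff_outer s).
Proof.
move=> A; apply: ge_ereal_sup => _ [d d0 <-].
apply: (@le_trans _ _ (\sum_(i <oo) hausdorff_content s d (A i))).
  exact: (cover_outer_sigma_subadditive id (@cost_ge0 d) A).
apply: lee_nneseries => [i _ _|i _]; first exact: (cover_outer_ge0 id (@cost_ge0 d)).
by apply: ereal_sup_ubound; exists d.
Qed.

HB.instance Definition _ := isOuterMeasure.Build R T (hausdorff_outer s)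
  hausdorff_outer0 hausdorff_outer_ge0 le_hausdorff_outer
  hausdorff_outer_sigma_subadditive.

End hausdorff.

Section quasisymmetry.
Context {R : realType}.

Definition homeomorphism {X Y : topologicalType} (A : set X) (B : set Y)
    (f : X -> Y) :=
  [/\ set_bij A B f, {within A, continuous f} &
    exists2 h : Y -> X, {in A, cancel f h} & {within B, continuous h}].

Definition quasisymmetric {X Y : metricType R} (g : X -> Y) :=
  homeomorphism [set: X] [set: Y] g /\
  exists eta : R -> R,
    [/\ homeomorphism (`[0, +oo[ : set R) (`[0, +oo[ : set R) eta,
        {in `[0, +oo[ &, {homo eta : s t / s < t :> R}} &
        forall x y z : X, x != z ->
          mdist (g x) (g y) / mdist (g x) (g z) <=
          eta (mdist x y / mdist x z)].

Definition conformal_dim (X : metricType R) : \bar R :=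
  ereal_inf [set d | exists (Y : metricType R) (g : X -> Y),
    quasisymmetric g /\ d = hausdorff_dim (range g)].

End quasisymmetry.

Section kakeya.
Context {R : realType} {n : nat}.
Local Notation E := (euclid R n).

Definition usphere : set E := [set e | enorm e = 1].

Definition unit_segment (e x : E) : set E :=
  [set x + t *: e | t in `[0, 1]].

Definition tube (delta : R) (e x : E) : set E :=
  [set y | inf [set mdist y z | z in unit_segment e x] <= delta].

Definition kakeya_maximal (delta : R) (f : E -> R) (e : E) : \bar R :=
  ereal_sup [set ((lebesgue R n (tube delta e x))^-1 *
    \int[lebesgue R n]_(y in tube delta e x) `|f y|%:E)%E | x in [set: E]].

Definition surface_outer : {outer_measure set E -> \bar R} :=
  @hausdorff_outer R E n.-1%:R.

(* The points of [R^n] with the sigma-algebra of Caratheodory measurable sets of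
   the [(n-1)]-dimensional Hausdorff outer measure. *)
Definition surfaceT := caratheodory_type surface_outer.

Definition surface : {measure set surfaceT -> \bar R} :=
  surface_outer : set surfaceT -> \bar R.

Definition kakeya_maximal_conjecture :=
  forall eps : R, 0 < eps -> exists C : R, forall delta : R, 0 < delta < 1 ->
    forall f : lebesgueT R n -> R, f \in Lfun (lebesgue R n) n%:R%:E ->
    ('N[surface]_n%:R%:E[(kakeya_maximal delta f : surfaceT -> \bar R) \_ usphere]
      <= (C * delta `^ (- eps))%:E * 'N[lebesgue R n]_n%:R%:E[EFin \o f])%E.

Definition kakeya_set (K : set E) :=
  exists S : set E, [/\ S `<=` usphere, (0 < surface_outer S)%E &
    forall e, S e -> exists x, unit_segment e x `<=` K].

End kakeya.
Arguments kakeya_maximal_conjecture : clear implicits.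

(* Main.v *)
Require Import Defs.
From HB Require Import structures.
From mathcomp Require Import all_boot all_order all_algebra.
From mathcomp Require Import all_classical all_reals all_analysis.
From mathcomp Require Import measurable_realfun ring lra.

Set Implicit Arguments.
Unset Strict Implicit.
Unset Printing Implicit Defensive.
Import Order.TTheory GRing.Theory Num.Theory.
Import numFieldNormedType.Exports.
(* [all_algebra] shadows [Defs.coord] by [vector.coord]. *)
Import Defs.

Local Open Scope classical_set_scope.
Local Open Scope ring_scope.

(* The identity of [K] gives the upper bound, a subset of [R^n] having dimension
   at most [n].  For the lower bound let [g] be quasisymmetric on [K] with
   [H^s(g K) = 0] and [s < n], and cover [g K] by sets [V_k] with
   [sum diam(V_k)^s] small.  A preimage of [V_k] sits in a cell [Q_k] of a grid
   whose mesh is comparable to its size [delta_k], and quasisymmetry bounds the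
   [g]-image of the neighbourhood of [Q_k] by a multiple of [v_k <= diam V_k];
   keeping one [k] per cell makes the cells of each dyadic scale disjoint.
   The image of a segment [L_e] in [K] is connected, so the [v_k] of the cells
   that [L_e] meets add up to at least a constant.  By the pigeonhole principle
   some scale [delta] contributes at least [c delta^eps]: at this scale the
   Kakeya maximal function of [sum_k v_k 1_{Q_k}] is large at [e].  The maximal
   inequality bounds the measure of such directions by a multiple of
   [delta^(-2 n eps) sum_k v_k^n], and since [g] is Hoelder continuous along
   the segments, [v_k^(n-s)] absorbs the loss; the sum over the scales is at
   most a multiple of [sum diam(V_k)^s]. *)

(** * Covers and the volume of boxes *)

Section covers.
Context {R : realType} {T : Type}.
Local Open Scope ereal_scope.

(** This turns sums over a countable cover into series over [nat]; [P], the image of [D] under an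
    injection into [nat], allows finite and empty covers. *)
Lemma countable_enum (I : pointedType) (D : set I) : countable D ->
  exists (P : pred nat) (g : nat -> I), set_bij [set k | P k] D g.
Proof.
move=> /countable_injP[f finj].
pose Q k x := D x /\ f x = k.
have [g gP] : {g : nat -> I & forall k, (f @` D) k -> Q k (g k)}.
  apply: (@choice _ _ (fun k x => (f @` D) k -> Q k x)) => k.
  have [[x Dx fx]|nk] := pselect ((f @` D) k); first by exists x.
  by exists point => /nk.
exists (fun k => `[< (f @` D) k >]), g; split.
- by move=> k /= /asboolP/gP[].
- move=> k l; rewrite !inE/= => /asboolP/gP[_ fk] /asboolP/gP[_ fl] gkl.
  by rewrite -fk -fl gkl.
- move=> x Dx; have fDx : (f @` D) (f x) by exists x.
  exists (f x) => /=; first exact/asboolP.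
  have [Dg fg] := gP _ fDx.
  by apply: finj => //; rewrite inE.
Qed.

(** A cover is a set of indices and cannot repeat one, so [F] is first made injective by keeping a
    single [j] in each fibre; this only lowers a sum of nonnegative costs. *)
Lemma cover_outer_le (I J : choiceType) (C : set I) (U : I -> set T)
    (c : I -> \bar R) (c0 : forall i, C i -> 0 <= c i) (A : set T)
    (E : set J) (F : J -> I) :
  countable E -> (forall j, E j -> C (F j)) ->
  A `<=` \bigcup_(j in E) U (F j) ->
  cover_outer C U c A <= \esum_(j in E) c (F j).
Proof.
move=> cE EC AE.
have [E' [E'E FE' Finj]] : exists E', [/\ E' `<=` E, F @` E' = F @` E &
    set_inj E' F].
  have [h hP] : {h : I -> option J & forall i, (F @` E) i ->
      exists2 j, E j /\ F j = i & h i = Some j}.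
    apply: (@choice _ _ (fun i o => (F @` E) i ->
      exists2 j, E j /\ F j = i & o = Some j)) => i.
    have [[j Ej Fj]|ni] := pselect ((F @` E) i); first by exists (Some j); exists j.
    by exists None => /ni.
  exists [set j | E j /\ h (F j) = Some j]; split.
  - by move=> j [].
  - apply/seteqP; split => [_ [j [Ej _] <-]|_ [j Ej <-]]; first by exists j.
    have [|k [Ek Fk] hk] := hP (F j); first by exists j.
    by exists k; rewrite //= Fk.
  - by move=> j k; rewrite !inE => -[_ hj] [_ hk] Fjk; move: hj; rewrite Fjk hk => -[].
apply: (@le_trans _ _ (\esum_(j in E') c (F j))).
  rewrite -esum_image//; apply: ereal_inf_lbound.
  exists (F @` E') => //; split.
  - by rewrite FE'; exact: sub_countable (card_image_le _ _) cE.
  - by move=> _ [j /E'E Ej <-]; exact: EC.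
  - by move=> t /AE[j Ej Ut]; exists (F j) => //; rewrite FE'; exists j.
rewrite [leRHS](@eq_esum _ _ _ _ (fun j => if j \in E then c (F j) else 0)); last first.
  by move=> j Ej; rewrite mem_set.
rewrite [leRHS](esumID E')//; last by move=> j Ej; rewrite mem_set//; exact/c0/EC.
have -> : E `&` E' = E' by exact/setIidPr.
rewrite [X in X + _](@eq_esum _ _ _ _ (fun j => c (F j))).
  by rewrite leeDl//; apply: esum_ge0 => j [Ej _]; rewrite mem_set//; exact/c0/EC.
by move=> j /E'E Ej; rewrite mem_set.
Qed.

End covers.

(* Fubini for covers: integrating the inequality in the last coordinate turns
   each weight [w k] into [w k * (b k n - a k n)]. *)
Lemma box_cover_volume (R : realType) (n : nat) (A B : nat -> R)
    (a b : nat -> nat -> R) (w : nat -> R) (c : R) :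
  (forall i, (i < n)%N -> A i <= B i) ->
  (forall k i, (i < n)%N -> a k i <= b k i) ->
  (forall k, 0 <= w k) ->
  (forall x : nat -> R, (forall i, (i < n)%N -> A i <= x i <= B i) ->
    (c%:E <= \sum_(k <oo)
       (w k * [forall i : 'I_n, a k i <= x i <= b k i]%:R)%:E)%E) ->
  ((c * \prod_(i < n) (B i - A i))%:E <=
     \sum_(k <oo) (w k * \prod_(i < n) (b k i - a k i))%:E)%E.
Proof.
elim: n w c => [|n IH] w c AB ab w0 H.
  have := H A (fun i => _); rewrite big_ord0 mulr1 => /(_ (fun _ => fun h => ltac:(by []))).
  move=> /le_trans; apply.
  apply: lee_nneseries => k _; first by rewrite lee_fin mulr_ge0.
  by rewrite big_ord0 lee_fin ler_wpM2l// lern1 leq_b1.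
have -> : c * \prod_(i < n.+1) (B i - A i) =
    c * (B n - A n) * \prod_(i < n) (B i - A i).
  by rewrite big_ord_recr/=; ring.
have -> : (\sum_(k <oo) (w k * \prod_(i < n.+1) (b k i - a k i))%:E =
    \sum_(k <oo) (w k * (b k n - a k n) * \prod_(i < n) (b k i - a k i))%:E)%E.
  by apply: eq_eseriesr => k _; congr EFin; rewrite big_ord_recr/=; ring.
apply: IH.
- by move=> i ni; apply: AB; rewrite ltnW.
- by move=> k i ni; apply: ab; rewrite ltnW.
- by move=> k; rewrite mulr_ge0// subr_ge0 ab.
move=> x xAB.
pose y t i := if i == n then t else x i.
have yE t k : [forall i : 'I_n.+1, a k i <= y t i <= b k i] =
    [forall i : 'I_n, a k i <= x i <= b k i] && (a k n <= t <= b k n).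
  apply/forallP/andP => [h|[/forallP h1 h2] i].
    split; last by have := h ord_max; rewrite /y/= eqxx.
    apply/forallP => i; have := h (widen_ord (leqnSn n) i).
    by rewrite /y/= ltn_eqF.
  rewrite /y; case: eqVneq => [->//|ni].
  have ltin : (i < n)%N by rewrite ltn_neqAle ni -ltnS ltn_ord.
  exact: h1 (Ordinal ltin).
pose ind t k := (w k * [forall i : 'I_n.+1, a k i <= y t i <= b k i]%:R)%R.
pose v k := (w k * [forall i : 'I_n, a k i <= x i <= b k i]%:R)%R.
have v0 k : 0 <= v k by rewrite mulr_ge0.
have indE k t : ind t k = v k * \1_(`[a k n, b k n]%classic : set R) t.
  rewrite /ind yE /v indicE mem_setE/= in_itv/=.
  by case: [forall i, _]; case: (_ <= _ <= _); rewrite ?mulr0 ?mulr1.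
have ABn : A n <= B n by exact: AB.
have muI (p q : R) : p <= q ->
    lebesgue_measure (`[p, q]%classic : set R) = (q - p)%:E.
  rewrite lebesgue_measure_itv/= lte_fin le_eqVlt => /predU1P[->|->].
    by rewrite ltxx subrr.
  by rewrite EFinB.
apply: (@le_trans _ _ (\int[lebesgue_measure]_(t in `[A n, B n]%classic) c%:E)%E).
  by rewrite integral_cst//= muI// EFinM.
apply: (@le_trans _ _ (\int[lebesgue_measure]_(t in `[A n, B n]%classic)
    (\sum_(k <oo) (v k * \1_(`[a k n, b k n]%classic : set R) t)%:E))%E).
  have mk k : measurable_fun (`[A n, B n]%classic : set R)
      (EFin \o (fun t : R => v k * \1_(`[a k n, b k n]%classic : set R) t)).
    by apply/measurable_EFinP; apply: measurable_funM => //; exact: measurable_indic.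
  (* The integrals are compared for nonnegative integrands; if [c < 0], the left side is at most 0
     and the right side at least 0. *)
  have [c0|/ltW c0] := leP 0 c.
    apply: ge0_le_integral => //=.
    - apply: (@ge0_emeasurable_sum _ _ _ _
        (fun k => EFin \o
          (fun t : R => v k * \1_(`[a k n, b k n]%classic : set R) t)) xpredT) => //.
      by move=> k t _ _; rewrite /= lee_fin mulr_ge0.
    - move=> t; rewrite in_itv/= => tAB.
      have := H (y t); under eq_eseriesr do rewrite -/(ind _ _) indE.
      apply => i; rewrite /y; case: eqVneq => [->//|ni].
      rewrite ltnS leq_eqVlt (negbTE ni)/=; exact: xAB.
  apply: (@le_trans _ _ 0%E).
    by rewrite integral_cst//= muI// lee_fin mulr_le0_ge0// subr_ge0.
  by apply: integral_ge0 => t _; apply: nneseries_ge0 => k _ _; rewrite lee_fin mulr_ge0.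
rewrite integral_nneseries//=; last first.
- by move=> k t _; rewrite lee_fin mulr_ge0.
- by move=> k; apply/measurable_EFinP; apply: measurable_funM => //; exact: measurable_indic.
apply: lee_nneseries => k _.
  by move=> _; apply: integral_ge0 => t _; rewrite lee_fin mulr_ge0.
under eq_integral do rewrite EFinM.
rewrite ge0_integralZl//=; last 2 first.
- by apply/measurable_EFinP; exact: measurable_indic.
- by rewrite lee_fin.
rewrite integral_indic//= mulrAC -/(v k) [leRHS]EFinM; apply: lee_pmul; rewrite ?lee_fin//.
by rewrite -muI ?ab//; apply: le_measure; rewrite ?inE//; exact: measurableI.
Qed.

(** * Lebesgue measure of grid cells *)

Lemma nneseries_ge_term (R : realType) (u : nat -> \bar R) k :
  (forall i, 0 <= u i)%E -> (u k <= \sum_(i <oo) u i)%E.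
Proof.
move=> u0; rewrite (@nneseriesD1 _ _ k xpredT)// leeDl//.
by apply: nneseries_ge0 => i _ _.
Qed.

Section lebesgue_boxes.
Context {R : realType} {n : nat}.
Local Notation E := (euclid R n).
Implicit Types (x y : E) (ab : E * E).

Lemma coord_row (F : 'I_n -> R) i : coord (\row_j F j : E) i = F i.
Proof. by rewrite /coord mxE. Qed.

Lemma box_volume_ge0 ab : ordered_box ab -> (0 <= box_volume ab)%E.
Proof.
by move=> oab; rewrite lee_fin; apply: prodr_ge0 => i _; rewrite subr_ge0.
Qed.

Definition with_coord x i t : E := \row_j (if j == i then t else coord x j).

Lemma coord_with x i t j :
  coord (with_coord x i t) j = if j == i then t else coord x j.
Proof. exact: coord_row. Qed.

(* Clamping [c] to the [i]-th side of the box cuts it into two boxes, the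
   second one or the first one being flat when the hyperplane misses it. *)
Let cut ab i c := Num.max (coord ab.1 i) (Num.min (coord ab.2 i) c).
Let lo i c ab : E * E := (ab.1, with_coord ab.2 i (cut ab i c)).
Let hi i c ab : E * E := (with_coord ab.1 i (cut ab i c), ab.2).

Let cutP ab i c : ordered_box ab ->
  coord ab.1 i <= cut ab i c <= coord ab.2 i.
Proof.
move=> oab; rewrite /cut le_max lexx/= ge_max oab/=.
by rewrite ge_min lexx.
Qed.

Let ordered_lo i c ab : ordered_box ab -> ordered_box (lo i c ab).
Proof.
move=> oab j /=; rewrite coord_with; case: eqVneq => [->|_]; last exact: oab.
by case/andP: (cutP i c oab).
Qed.

Let ordered_hi i c ab : ordered_box ab -> ordered_box (hi i c ab).
Proof.
move=> oab j /=; rewrite coord_with; case: eqVneq => [->|_]; last exact: oab.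
by case/andP: (cutP i c oab).
Qed.

Let volume_cut i c ab :
  (box_volume ab = box_volume (lo i c ab) + box_volume (hi i c ab))%E.
Proof.
rewrite /box_volume -EFinD; congr EFin.
rewrite (bigD1 i)//= [X in _ = X + _](bigD1 i)//= [X in _ = _ + X](bigD1 i)//=.
rewrite !coord_with eqxx.
rewrite [X in _ = _ * X + _](eq_bigr (fun j => coord ab.2 j - coord ab.1 j)).
  rewrite [X in _ = _ + _ * X](eq_bigr (fun j => coord ab.2 j - coord ab.1 j)).
    by ring.
  by move=> j /negbTE ji; rewrite coord_with ji.
by move=> j /negbTE ji; rewrite coord_with ji.
Qed.

(** Cutting every box of a cover of [X] along the hyperplane gives covers of the two parts of [X]
    with the same total volume. *)
Lemma half_space_measurable i c :
  (lebesgue_outer_measure R n).-caratheodory [set x : E | coord x i < c].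
Proof.
apply: le_caratheodory_measurable => X.
apply: le_ereal_inf_tmp => _ [D [cD DC XD] <-].
rewrite (eq_esum (fun ab _ => volume_cut i c ab)).
rewrite esumD; last 2 first.
- by move=> ab /DC oab; apply/box_volume_ge0/ordered_lo.
- by move=> ab /DC oab; apply/box_volume_ge0/ordered_hi.
apply: leeD; apply: cover_outer_le => //.
- exact: box_volume_ge0.
- by move=> ab /DC; exact: ordered_lo.
- move=> x [/XD[ab Dab abx] /= xc]; exists ab => //= j /=.
  rewrite coord_with; case: eqVneq => [->|_]; last exact: abx.
  have /andP[-> xb] /= := abx i.
  by rewrite /cut le_max le_min xb (ltW xc) orbT.
- exact: box_volume_ge0.
- by move=> ab /DC; exact: ordered_hi.
- move=> x [/XD[ab Dab abx] /= /negP]; rewrite -leNgt => cx; exists ab => //= j /=.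
  rewrite coord_with; case: eqVneq => [->|_]; last exact: abx.
  have /andP[ax ->] := abx i.
  by rewrite andbT /cut ge_max ax ge_min cx orbT.
Qed.

Lemma lebesgue_outer_box_le ab : ordered_box ab ->
  (lebesgue_outer (box ab) <= box_volume ab)%E.
Proof.
move=> oab; apply: le_trans (@cover_outer_le _ _ _ unit _ _ _ box_volume_ge0 _
  [set: unit] (fun _ => ab) _ _ _) _ => //.
- exact: countableP.
- by move=> x abx; exists tt.
- by rewrite (_ : [set: unit] = [set tt]) ?esum_set1// ?box_volume_ge0//;
    apply/seteqP; split => // -[].
Qed.

(** The indicators of the boxes of a cover add up to at least 1 on the covered box, so
    [box_cover_volume] applies with [c = 1]. *)
Lemma lebesgue_outer_box_ge ab : ordered_box ab ->
  (box_volume ab <= lebesgue_outer (box ab))%E.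
Proof.
move=> oab; apply: le_ereal_inf_tmp => _ [D [cD DC abD] <-].
have [P [g gbij]] := countable_enum cD.
have [gD _ gsurj] := gbij.
have Pg k : P k -> ordered_box (g k) by move=> Pk; exact/DC/gD.
rewrite (reindex_esum _ _ _ _ gbij) -nneseries_esum; last first.
  by move=> k /Pg; exact: box_volume_ge0.
(* Coordinates are extended by 0 to all of [nat], the form in which [box_cover_volume] does its
   induction on the dimension. *)
pose nc x i := oapp (coord x) 0 (insub i).
have ncE x (i : 'I_n) : nc x i = coord x i by rewrite /nc valK.
(* Indices outside [P] get a one-point box and, below, the weight 0. *)
pose h k := if P k then g k else (0, 0).
have oh k i : nc (h k).1 i <= nc (h k).2 i.
  rewrite /h/nc; case: insubP => //= j _ _.
  by case: ifPn => [/Pg/(_ j)//|_]; rewrite !coord0.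
have := @box_cover_volume R n (nc ab.1) (nc ab.2) (fun k => nc (h k).1)
  (fun k => nc (h k).2) (fun k => (P k)%:R) 1.
have prodE ab' : (\prod_(i < n) (nc ab'.2 i - nc ab'.1 i))%:E = box_volume ab'.
  by congr EFin; apply: eq_bigr => i _; rewrite !ncE.
rewrite mul1r prodE => H.
apply: le_trans (H _ _ _ _) _.
- by move=> i ni; rewrite -[i]/(val (Ordinal ni)) !ncE.
- by move=> k i _; exact: oh.
- by [].
- move=> x xab; pose y : E := \row_i x i.
  have /abD[_ /gsurj[k /= Pk <-] yk] : box ab y.
    by move=> i; rewrite coord_row -!ncE; exact: xab.
  apply: (@le_trans _ _ (((P k)%:R *
      [forall i : 'I_n, nc (h k).1 i <= x i <= nc (h k).2 i]%:R)%:E)).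
    rewrite lee_fin Pk mul1r (_ : [forall i, _])//.
    by apply/forallP => i; rewrite /h Pk !ncE; have := yk i; rewrite coord_row.
  by apply: (@nneseries_ge_term R (fun k => _)) => j; rewrite lee_fin mulr_ge0.
rewrite [leRHS]eseries_mkcond; apply: lee_nneseries => k _.
  by rewrite lee_fin mulr_ge0// prodr_ge0// => i _; rewrite subr_ge0 oh.
rewrite EFinM prodE /h; by case: (P k); rewrite ?mul1e ?mul0e.
Qed.

End lebesgue_boxes.

Section cells.
Context {R : realType} {n : nat}.
Local Notation E := (euclid R n).
Implicit Types (x y z : E) (r : R).

(* The cube of the half-open grid of mesh [r] that contains [x]. *)
Definition cell r x : set E :=
  [set y | forall i, Num.floor (coord y i / r) = Num.floor (coord x i / r)].

Lemma mem_cell r x : cell r x x. Proof. by []. Qed.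

Definition corner r x : E := \row_i ((Num.floor (coord x i / r))%:~R * r).

Lemma cellE r x : 0 < r -> cell r x =
  [set y | forall i, coord (corner r x) i <= coord y i < coord (corner r x) i + r].
Proof.
move=> r0; apply/seteqP; split => y /= h i; have := h i.
  rewrite coord_row => <-; rewrite -ler_pdivlMr// ge_floor/=.
  rewrite -[X in _ < _ + X]mul1r -mulrDl -ltr_pdivrMr//.
  by have := floorD1_gt (coord y i / r); rewrite intrD.
rewrite coord_row => /andP[h1 h2]; apply: floor_def.
by rewrite ler_pdivlMr// ltr_pdivrMr// intrD mulrDl mul1r h1 h2.
Qed.

Lemma cell_measurable r x : 0 < r -> measurable (cell r x : set (lebesgueT R n)).
Proof.
move=> r0; rewrite cellE//.
rewrite (_ : [set y | _] = \bigcap_(i in [set: 'I_n])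
   (~` [set y : E | coord y i < coord (corner r x) i] `&`
   [set y : E | coord y i < coord (corner r x) i + r])).
  apply: fin_bigcap_measurable => // i _; apply: measurableI.
    by apply: measurableC; exact: half_space_measurable.
  exact: half_space_measurable.
apply/seteqP; split => y /= h i.
  by move=> _; have /andP[h1 h2] := h i; split => //=; apply/negP; rewrite -leNgt.
by have [//|/= /negP + ->] := h i; rewrite -leNgt => ->.
Qed.

Lemma cell_dist r x y z : 0 < r -> cell r x y -> cell r x z ->
  forall i, `|coord y i - coord z i| <= r.
Proof.
move=> r0; rewrite cellE// => hy hz i.
have /andP[y1 y2] := hy i; have /andP[z1 z2] := hz i.
by rewrite ler_norml; apply/andP; split; lra.
Qed.

Let boxr x r : E * E := (x, \row_i (coord x i + r)).

Let boxr_volume x r : box_volume (boxr x r) = (r ^+ n)%:E.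
Proof.
rewrite /box_volume/=; congr EFin.
under eq_bigr do rewrite coord_row addrAC subrr add0r.
by rewrite prodr_const card_ord.
Qed.

Lemma lebesgue_cell_le r x : 0 < r -> (lebesgue R n (cell r x) <= (r ^+ n)%:E)%E.
Proof.
move=> r0; rewrite -(boxr_volume (corner r x)).
apply: le_trans (lebesgue_outer_box_le _); last first.
  by move=> i; rewrite /= coord_row lerDl ltW.
apply: le_outer_measure; rewrite cellE// => y hy i /=.
by rewrite coord_row; have /andP[-> /ltW ->] := hy i.
Qed.

(** The half-open cell contains the closed cube of half the side at the same corner. *)
Lemma lebesgue_cell_ge r x : 0 < r ->
  (((r / 2) ^+ n)%:E <= lebesgue R n (cell r x))%E.
Proof.
move=> r0; rewrite -(boxr_volume (corner r x)).
apply: le_trans (lebesgue_outer_box_ge _) _.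
  by move=> i; rewrite /= coord_row lerDl divr_ge0// ltW.
apply: le_outer_measure; rewrite cellE// => y hy i /=.
have := hy i; rewrite /= coord_row => /andP[-> h2] /=.
by apply: le_lt_trans h2 _; rewrite ltrD2l; lra.
Qed.

Lemma lebesgue_cube_le (A : set E) x r : 0 <= r ->
  (forall y, A y -> forall i, `|coord y i - coord x i| <= r) ->
  (lebesgue_outer A <= ((2 * r) ^+ n)%:E)%E.
Proof.
move=> r0 Ar; pose c : E := \row_i (coord x i - r).
rewrite -(boxr_volume c); apply: le_trans (lebesgue_outer_box_le _); last first.
  by move=> i; rewrite /= coord_row lerDl mulr_ge0.
apply: le_cover_outer => y /Ar Ay i /=; rewrite !coord_row.
by have := Ay i; rewrite ler_norml => /andP[]; lra.
Qed.

End cells.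

(** * Tubes *)

Section tubes.
Context {R : realType} {n : nat}.
Local Notation E := (euclid R n).
Implicit Types (x y z e : E) (r d : R).

Lemma coordZ t x i : coord (t *: x) i = t * coord x i.
Proof. by rewrite /coord [LHS]mxE. Qed.

Lemma enormZ t x : enorm (t *: x) = `|t| * enorm x.
Proof.
rewrite /enorm -sqrtr_sqr -sqrtrM ?sqr_ge0// mulr_sumr; congr Num.sqrt.
by apply: eq_bigr => i _; rewrite coordZ exprMn.
Qed.

Lemma mdistE x y : mdist x y = enorm (x - y). Proof. by []. Qed.

Lemma coord_le_enorm x i : `|coord x i| <= enorm x.
Proof.
rewrite -(@ler_pXn2r _ 2)// ?nnegrE ?enorm_ge0// enorm_sqr real_normK ?num_real//.
by rewrite (bigD1 i)//= lerDl sumr_ge0// => j _; exact: sqr_ge0.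
Qed.

Lemma enorm_le_coord x r : 0 <= r -> (forall i, `|coord x i| <= r) ->
  enorm x <= n%:R * r.
Proof.
move=> r0 xr; rewrite -(@ler_pXn2r _ 2)// ?nnegrE ?enorm_ge0 ?mulr_ge0//.
rewrite enorm_sqr; apply: (@le_trans _ _ (\sum_(i < n) r ^+ 2)).
  apply: ler_sum => i _; rewrite -real_normK ?num_real//.
  by rewrite ler_pXn2r ?nnegrE.
rewrite sumr_const card_ord -[leLHS]mulr_natl [leRHS]exprMn ler_wpM2r ?sqr_ge0//.
by rewrite -natrX ler_nat; case: (n) => // m; rewrite expnS leq_pmulr// expn_gt0.
Qed.

Lemma coord_le_mdist x y i : `|coord x i - coord y i| <= mdist x y.
Proof. by rewrite -coordN -coordD; exact: coord_le_enorm. Qed.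

Lemma cell_mdist r x y z : 0 < r -> cell r x y -> cell r x z ->
  mdist y z <= n%:R * r.
Proof.
move=> r0 xy xz; apply: enorm_le_coord; first exact: ltW.
by move=> i; rewrite coordD coordN; exact: cell_dist xy xz i.
Qed.

Lemma segment_mdist e x t u : usphere e ->
  mdist (x + t *: e) (x + u *: e) = `|t - u|.
Proof.
move=> /= e1; rewrite mdistE opprD addrACA subrr add0r -scalerBl enormZ e1.
by rewrite mulr1.
Qed.

Lemma mem_tube d e x y z : unit_segment e x z -> mdist y z <= d -> tube d e x y.
Proof.
move=> xz yz; apply: le_trans yz; apply: ge_inf; last by exists z.
by exists 0 => _ [u _ <-]; exact: mdist_ge0.
Qed.

(** The factor 2 leaves room to approximate the infimum that defines the tube, in place of a nearest
    point given by compactness. *)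
Lemma tubeP d e x y : 0 < d -> tube d e x y ->
  exists2 z, unit_segment e x z & mdist y z < 2 * d.
Proof.
move=> d0 dxy.
have hinf : has_inf [set mdist y z | z in unit_segment e x].
  split; first by exists (mdist y (x + 0 *: e)), (x + 0 *: e) => //;
    exists 0 => //=; rewrite in_itv/= lexx ler01.
  by exists 0 => _ [u _ <-]; exact: mdist_ge0.
have [_ [z xz <-] zd] := inf_adherent d0 hinf.
exists z => //; apply: lt_le_trans zd _.
by rewrite mulr_natl mulr2n lerD2r.
Qed.

(** Turning the direction by [d] moves each point of the unit segment by at most [d], which adds to
    the [2 * d] of [tubeP]. *)
Lemma tube_perturb d e f x : usphere e -> mdist e f <= d -> 0 < d ->
  tube d e x `<=` tube (3 * d) f x.
Proof.
move=> e1 ef d0 y /(tubeP d0)[_ [t /= t01 <-] yz].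
apply: (@mem_tube _ _ _ _ (x + t *: f)); first by exists t.
apply: le_trans (metric_triangle _ (x + t *: e) _) _.
have : mdist (x + t *: e) (x + t *: f) <= d; last by lra.
rewrite mdistE opprD addrACA subrr add0r -scalerBr enormZ.
move: t01; rewrite in_itv/= => /andP[t0 t1]; rewrite ger0_norm//.
apply: le_trans ef; rewrite -[leRHS]mul1r; apply: ler_wpM2r => //.
exact: enorm_ge0.
Qed.

(** Cubes of side [6 * d] centred at the points [x + (k * d) *: e] cover the tube, and at most
    [3 / d] of them are used. *)
Lemma lebesgue_tube_le d e x : usphere e -> 0 < d < 1 ->
  (lebesgue R n (tube d e x) <= (3 * 6 ^+ n * d ^+ n / d)%:E)%E.
Proof.
move=> e1 /andP[d0 d1].
pose m := (Num.trunc d^-1).+1.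
pose Q (k : nat) := [set y : E |
  forall i, `|coord y i - coord (x + (k%:R * d) *: e) i| <= 3 * d].
apply: (@le_trans _ _ (lebesgue_outer_measure R n (\big[setU/set0]_(k < m) Q k))).
  apply: le_outer_measure => y /(tubeP d0)[_ [t /= t01 <-] yz].
  move: t01; rewrite in_itv/= => /andP[t0 t1].
  have td0 : 0 <= t / d by rewrite divr_ge0// ltW.
  have /andP[k1 k2] := truncn_itv td0.
  rewrite -bigcup_mkord; exists (Num.trunc (t / d)) => /=.
    by rewrite ltnS le_truncn// -[leRHS]mul1r ler_wpM2r// invr_ge0 ltW.
  move=> i; apply: le_trans (coord_le_mdist _ _ _) _.
  apply: le_trans (metric_triangle _ (x + t *: e) _) _.
  rewrite segment_mdist//.
  have : `|t - (Num.trunc (t / d))%:R * d| <= d.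
    rewrite ler_pdivlMr// in k1; rewrite ltr_pdivrMr// -addn1 natrD mulrDl mul1r in k2.
    by rewrite ler_norml; apply/andP; split; lra.
  by lra.
apply: le_trans (outer_measure_subadditive _ _ _) _.
apply: (@le_trans _ _ (\sum_(k < m) ((6 * d) ^+ n)%:E)%E).
  apply: lee_sum => k _.
  have -> : 6 * d = 2 * (3 * d) by ring.
  by apply: (@lebesgue_cube_le _ _ _ (x + (k%:R * d) *: e)) => //; rewrite mulr_ge0// ltW.
rewrite sumEFin lee_fin sumr_const card_ord -[leLHS]mulr_natl.
have -> : 3 * 6 ^+ n * d ^+ n / d = 3 / d * (6 * d) ^+ n by rewrite exprMn; ring.
rewrite ler_wpM2r ?exprn_ge0 ?mulr_ge0 ?(ltW d0)//.
have : (Num.trunc d^-1)%:R <= d^-1 by rewrite truncn_le invr_ge0 ltW.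
have : 1 <= d^-1 by rewrite invf_ge1// ltW.
by rewrite /m -addn1 natrD; lra.
Qed.

End tubes.

(** * Integrals of functions that may fail to be measurable *)

Section nonmeasurable_integrands.
Local Open Scope ereal_scope.
Context d (T : measurableType d) (R : realType).
Variable mu : {measure set T -> \bar R}.

(* The Lebesgue integral of the library is a supremum over the simple functions
   below the integrand: these bounds need no measurability. *)
Lemma ge0_le_integralT (f g : T -> \bar R) :
  (forall x, 0 <= f x) -> (forall x, f x <= g x) ->
  \int[mu]_x f x <= \int[mu]_x g x.
Proof.
move=> f0 fg; rewrite !ge0_integralTE//; last by move=> x; exact: le_trans (fg x).
by apply: ereal_sup_le => _ [h hf <-]; exists h => // x; exact: le_trans (fg x).
Qed.

Lemma ge0_subset_integralT (A B : set T) (f : T -> \bar R) :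
  A `<=` B -> (forall x, 0 <= f x) ->
  \int[mu]_(x in A) f x <= \int[mu]_(x in B) f x.
Proof.
move=> AB f0; rewrite integral_mkcond [leRHS]integral_mkcond.
apply: ge0_le_integralT => x; first exact: erestrict_ge0.
exact: restrict_lee.
Qed.

Lemma integral_ge_cst (A : set T) (f : T -> \bar R) (c : R) :
  measurable A -> (0 <= c)%R -> (forall x, 0 <= f x) ->
  (forall x, A x -> c%:E <= f x) ->
  c%:E * mu A <= \int[mu]_x f x.
Proof.
move=> mA c0 f0 cf; rewrite -integral_cst// integral_mkcond.
apply: ge0_le_integralT => x; first exact: erestrict_ge0.
by rewrite patchE; case: ifPn => // /set_mem/cf.
Qed.

End nonmeasurable_integrands.

(** * Caratheodory's criterion and Hausdorff measure *)

Section caratheodory_criterion.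
Context {R : realType} {T : metricType R}.
Local Open Scope ereal_scope.

Definition separated_by (r : R) (A B : set T) :=
  forall x y, A x -> B y -> (r <= mdist x y)%R.

Variable mu : {outer_measure set T -> \bar R}.
Hypothesis metric_mu : forall (r : R) A B, (0 < r)%R -> separated_by r A B ->
  mu A + mu B <= mu (A `|` B).

Variable phi : T -> R.
Hypothesis phi_lip : forall x y, (phi x - phi y <= mdist x y)%R.

Let u k : R := k.+1%:R^-1.

Let u_gt0 k : (0 < u k)%R. Proof. by rewrite invr_gt0. Qed.

Let u_lt k l : (k < l)%N -> (u l < u k)%R.
Proof. by move=> kl; rewrite ltf_pV2 ?posrE// ltr_nat ltnS. Qed.

Let u_le k l : (k <= l)%N -> (u l <= u k)%R.
Proof. by move=> kl; rewrite lef_pV2 ?posrE// ler_nat ltnS. Qed.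

(** Layers of [X] that accumulate at the boundary of the set where [phi > 0]. As [phi] is
    1-Lipschitz, two layers that are not consecutive lie at a positive distance. *)
Let ring X k : set T := X `&` [set x | u k.+1 < phi x <= u k]%R.

Let ring_sum X p N :
  \sum_(k < N) mu (ring X (k.*2 + p)) <=
  mu (\bigcup_(k in `I_N) ring X (k.*2 + p)).
Proof.
elim: N => [|[|N] IH]; first by rewrite big_ord0 outer_measure_ge0.
  by rewrite big_ord1 bigcup_mkord big_ord1.
rewrite big_ord_recr/=; apply: le_trans (leeD2r _ IH) _.
apply: le_trans (@metric_mu (u (N.*2 + p).+1 - u (N.*2 + p).+2) _ _ _ _) _.
- by rewrite subr_gt0 u_lt.
- move=> x y [k /= kN [_ /andP[x1 _]]] [_ /= /andP[_ y2]].
  apply: le_trans (phi_lip x y).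
  have : (u (N.*2 + p).+1 <= u (k.*2 + p).+1)%R.
    by apply: u_le; rewrite ltnS leq_add2r leq_double -ltnS.
  by move: y2; rewrite doubleS !addSn; lra.
- apply: le_outer_measure => x [[k /= kN Rx]|Rx]; last by exists N.+1 => /=.
  by exists k => //=; rewrite ltnW.
Qed.

(** The even layers are mutually separated, and so are the odd ones: each family contributes at most
    [mu X]. *)
Let ring_series X : \sum_(k <oo) mu (ring X k) <= 2%:E * mu X.
Proof.
apply: lime_le; first by apply: is_cvg_nneseries => k _ _; exact: outer_measure_ge0.
apply: nearW => m.
have ringX p N : \sum_(k < N) mu (ring X (k.*2 + p)) <= mu X.
  apply: le_trans (ring_sum X p N) _.
  by apply: le_outer_measure => x [k _ []].
have -> : (2%:E : \bar R) = 1 + 1 by rewrite -EFinD.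
rewrite ge0_muleDl// mul1e.
apply: le_trans (leeD (ringX 0%N m) (ringX 1%N m)).
rewrite -big_split/=.
rewrite -(big_mkord xpredT
  (fun k => mu (ring X (k.*2 + 0)) + mu (ring X (k.*2 + 1)))).
apply: (@le_trans _ _ (\sum_(0 <= k < m.*2) mu (ring X k))).
  rewrite [leRHS](big_cat_nat (n := m))//=; last by rewrite -addnn leq_addr.
  by rewrite leeDl// sume_ge0// => k _; exact: outer_measure_ge0.
elim: m => [|m IH]; first by rewrite !big_geq.
rewrite doubleS !big_nat_recr//= -addeA; apply: leeD => //.
by rewrite addn0 addn1.
Qed.

(** The part of [X] where [phi > u N] is separated from the part where [phi <= 0], so [mu] is
    superadditive on them; what is left over lies in the layers from [N] on, a tail of a convergent
    series. *)
Lemma caratheodory_pos_lip : mu.-caratheodory [set x | 0 < phi x]%R.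
Proof.
apply: le_caratheodory_measurable => X.
have [->|Xoo] := eqVneq (mu X) +oo; first by rewrite leey.
have tail0 : (fun N => \sum_(N <= k <oo) mu (ring X k)) @ \oo --> 0.
  apply: nneseries_tail_cvg; last by move=> k _; exact: outer_measure_ge0.
  apply: le_lt_trans (ring_series X) _.
  by rewrite lte_mul_pinfty// ltey.
have main N : mu (X `&` [set x | 0 < phi x]%R) + mu (X `&` ~` [set x | 0 < phi x]%R)
    <= mu X + \sum_(N <= k <oo) mu (ring X k).
  apply: (@le_trans _ _ (mu (X `&` [set x | u N < phi x]%R) +
      \sum_(N <= k <oo) mu (ring X k) + mu (X `&` ~` [set x | 0 < phi x]%R))).
    apply: leeD2r; apply: le_trans (leeD2l _ (outer_measure_sigma_subadditive_tail _ _ _)).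
    apply: le_trans (outer_measureU2 _ _ _).
    apply: le_outer_measure => x [Xx /= px].
    have [|xN] := ltP (u N) (phi x); first by left.
    right.
    have [k uk] : exists k, (u k < phi x)%R.
      exists (Num.bound (phi x)^-1); rewrite -[ltRHS]invrK ltf_pV2 ?posrE ?invr_gt0//.
      apply: lt_trans (archi_boundP _) _; first by rewrite invr_ge0 ltW.
      by rewrite ltr_nat.
    (* For the least [m] with [u m < phi x], the point lies in the layer [m - 1], and
       [N <= m - 1]. *)
    pose P k := (u k < phi x)%R.
    have exP : exists k, P k by exists k.
    case: (ex_minnP exP) => m Pm mmin.
    have Nm : (N < m)%N.
      rewrite ltnNge; apply/negP => /u_le h.
      by move: Pm; rewrite /P ltNge (le_trans xN h).
    exists m.-1 => /=; first by apply/negP; rewrite -leqNgt -ltnS prednK// (leq_trans _ Nm).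
    split => //=; rewrite prednK ?(leq_trans _ Nm)//; apply/andP; split => //.
    rewrite leNgt; apply/negP => /mmin.
    by rewrite leqNgt ltn_predL (leq_trans _ Nm).
  rewrite addeAC; apply: leeD2r.
  apply: le_trans (@metric_mu (u N) _ _ _ _) _ => //.
    move=> x y [_ /= ux] [_ /= /negP]; rewrite -leNgt => y0.
    by apply: le_trans (phi_lip x y); lra.
  by apply: le_outer_measure => x [[]|[]].
have lim0 : (fun N => mu X + \sum_(N <= k <oo) mu (ring X k)) @ \oo --> mu X + 0.
  by apply: cvgeD tail0 => //; [rewrite fin_num_adde_defl|exact: cvg_cst].
rewrite -[leRHS]adde0 -(cvg_lim _ lim0)//.
by apply: lime_ge; [apply/cvg_ex; eexists; exact: lim0|exact: nearW].
Qed.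

End caratheodory_criterion.

(** * Hausdorff measure as a metric outer measure *)

Section hausdorff_caratheodory.
Context {R : realType} {T : metricType R}.
Local Open Scope ereal_scope.
Variable s : R.

Lemma hausdorff_content_antitone (d d' : R) (A : set T) : (d <= d')%R ->
  hausdorff_content s d' A <= hausdorff_content s d A.
Proof.
move=> dd'; apply: ereal_inf_le_tmp => _ [D [cD Dd AD] <-]; exists D => //.
by split => // U /Dd/= /le_trans; apply; rewrite lee_fin.
Qed.

Lemma hausdorff_content_le_outer d (A : set T) : (0 < d)%R ->
  hausdorff_content s d A <= hausdorff_outer s A.
Proof. by move=> d0; apply: ereal_sup_ubound; exists d. Qed.

Lemma mdist_le_diameter (U : set T) x y : U x -> U y ->
  (mdist x y)%:E <= diameter U.
Proof. by move=> Ux Uy; apply: ereal_sup_ubound; exists x => //; exists y. Qed.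

(** A set of diameter below [r] cannot meet both [A] and [B], so a cover of the union splits into
    disjoint covers of the two. *)
Lemma hausdorff_content_metric (r d : R) (A B : set T) : (d < r)%R ->
  separated_by r A B ->
  hausdorff_content s d A + hausdorff_content s d B <=
  hausdorff_content s d (A `|` B).
Proof.
move=> dr sepAB; apply: le_ereal_inf_tmp => _ [D [cD Dd ABD] <-].
pose meets (C : set T) := [set U : set T | U `&` C !=set0].
have bound C : C `<=` A `|` B ->
    hausdorff_content s d C <= \esum_(U in D `&` meets C) diameter U `^ s.
  move=> CAB; apply: ereal_inf_lbound; exists (D `&` meets C) => //; split.
  - exact: sub_countable (subset_card_le (@subIsetl _ _ _)) cD.
  - by move=> U [/Dd].
  - by move=> x Cx; have [U DU Ux] := ABD _ (CAB _ Cx); exists U => //; split => //; exists x.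
apply: le_trans (leeD (bound A _) (bound B _)) _; first exact: subsetUl.
  exact: subsetUr.
rewrite [leRHS](esumID (meets A)); last by move=> U _; exact: poweR_ge0.
apply: leeD => //.
rewrite [leRHS](esumID (meets B)); last by move=> U _; exact: poweR_ge0.
rewrite [X in _ <= X + _](_ : _ = \esum_(U in D `&` meets B) diameter U `^ s).
  by rewrite leeDl// esum_ge0// => U _; exact: poweR_ge0.
congr esum; apply/seteqP; split => [U [[DU _] UB]|U [DU [y [Uy By]]]] //.
split; last by exists y.
split=> // -[x [Ux Ax]].
have := sepAB x y Ax By; rewrite leNgt => /negP; apply; apply: le_lt_trans dr.
by rewrite -lee_fin; apply: le_trans (mdist_le_diameter Ux Uy) (Dd _ DU).
Qed.

Lemma hausdorff_metric_outer (r : R) (A B : set T) : (0 < r)%R -> separated_by r A B ->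
  hausdorff_outer s A + hausdorff_outer s B <= hausdorff_outer s (A `|` B).
Proof.
move=> r0 sepAB; set H := hausdorff_outer s (A `|` B).
have [->|Hoo] := eqVneq H +oo; first by rewrite leey.
have fin (x : \bar R) : 0 <= x -> x <= H -> x \is a fin_num.
  by move=> x0 xH; rewrite ge0_fin_numE// (le_lt_trans xH)// ltey.
have c0 (d : R) (C : set T) : 0 <= hausdorff_content s d C.
  by apply: cover_outer_ge0 => U _; exact: poweR_ge0.
(* Passing to a common finer scale below [r] decouples [d1] from [d2], so that the two suprema can
   be taken one after the other. *)
have key (d1 d2 : R) : (0 < d1)%R -> (0 < d2)%R ->
    hausdorff_content s d1 A + hausdorff_content s d2 B <= H.
  move=> d10 d20; pose d := Num.min (Num.min d1 d2) (r / 2)%R.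
  have d0 : (0 < d)%R by rewrite !lt_min d10 d20 divr_gt0.
  apply: (@le_trans _ _ (hausdorff_content s d A + hausdorff_content s d B)).
    by apply: leeD; apply: hausdorff_content_antitone; rewrite !ge_min lexx ?orbT.
  apply: le_trans (hausdorff_content_le_outer _ d0).
  apply: hausdorff_content_metric sepAB.
  by apply: (@le_lt_trans _ _ (r / 2)%R); [rewrite ge_min lexx orbT|lra].
have cA (d : R) : (0 < d)%R -> hausdorff_content s d A + hausdorff_outer s B <= H.
  move=> d0; have fA : hausdorff_content s d A \is a fin_num.
    apply: fin => //; apply: le_trans (key d 1%R d0 _) => //.
    by rewrite leeDl.
  rewrite -leeBrDl//; apply: ge_ereal_sup => _ [d2 /= d20 <-].
  by rewrite leeBrDl//; exact: key.
have fB : hausdorff_outer s B \is a fin_num.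
  apply: fin; first exact: hausdorff_outer_ge0.
  by apply: le_trans (cA 1%R _) => //; rewrite leeDr.
rewrite -leeBrDr//; apply: ge_ereal_sup => _ [d /= d0 <-].
by rewrite leeBrDr//; exact: cA.
Qed.

Definition hausdorff_outer_measure : {outer_measure set T -> \bar R} :=
  @hausdorff_outer R T s.

(** The criterion applies to [r] minus the distance to [S]. This provides measurable sets around an
    arbitrary set of directions. *)
Lemma hausdorff_neighborhood_measurable (S : set T) (r : R) :
  hausdorff_outer_measure.-caratheodory
    [set y | exists2 x, S x & (mdist y x < r)%R].
Proof.
have [->|/set0P[x0 Sx0]] := eqVneq S set0.
  rewrite (_ : [set y | _] = set0); first exact: caratheodory_measurable_set0.
  by apply/seteqP; split => // y [].
have lb y : has_lbound [set mdist y x | x in S].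
  by exists 0%R => _ [x _ <-]; exact: mdist_ge0.
have ne y : [set mdist y x | x in S] !=set0 by exists (mdist y x0), x0.
rewrite (_ : [set y | _] = [set y | 0 < r - inf [set mdist y x | x in S]]%R).
  apply: caratheodory_pos_lip => [e A B e0|x y]; first exact: hausdorff_metric_outer e0.
  have : (inf [set mdist y z | z in S] - mdist x y <= inf [set mdist x z | z in S])%R.
    apply: lb_le_inf => // _ [z Sz <-]; rewrite lerBlDl metric_sym.
    apply: le_trans (metric_triangle y x z).
    by apply: ge_inf => //; exists z.
  by lra.
apply/seteqP; split => y /=; rewrite subr_gt0.
  by move=> [x Sx]; apply: le_lt_trans; apply: ge_inf => //; exists x.
by move=> /inf_lt-/(_ (ne y))[_ [x Sx <-] yx]; exists x.
Qed.

End hausdorff_caratheodory.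

(** The complement of the sphere is the union of the sets where the 1-Lipschitz functions
    [enorm x - 1] and [1 - enorm x] are positive. *)
Lemma usphere_measurable (R : realType) (n : nat) :
  (@surface_outer R n).-caratheodory (@usphere R n).
Proof.
have h (c : R) : `|c| <= 1 -> forall x y : euclid R n,
    c * (enorm x - 1) - c * (enorm y - 1) <= mdist x y.
  move=> c1 x y; rewrite -mulrBr opprB addrA subrK.
  apply: le_trans (ler_norm _) _; rewrite normrM.
  apply: (@le_trans _ _ `|enorm x - enorm y|).
    by rewrite -[leRHS]mul1r ler_wpM2r.
  have t (u v : euclid R n) : enorm u - enorm v <= enorm (u - v).
    by rewrite lerBlDr -[X in enorm X <= _](subrK v) enormD.
  have txy : enorm x - enorm y <= mdist x y := t x y.
  have tyx : enorm y - enorm x <= mdist x y by rewrite metric_sym; exact: t.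
  by rewrite ler_norml; apply/andP; split; lra.
have hp := caratheodory_pos_lip (@hausdorff_metric_outer R _ n.-1%:R) (h 1 _).
have hn := caratheodory_pos_lip (@hausdorff_metric_outer R _ n.-1%:R) (h (-1) _).
rewrite (_ : usphere = ~` ([set x : euclid R n | 0 < 1 * (enorm x - 1)] `|`
    [set x | 0 < -1 * (enorm x - 1)])).
  apply: caratheodory_measurable_setC; apply: caratheodory_measurable_setU.
    by apply: hp; rewrite normr1.
  by apply: hn; rewrite normrN normr1.
apply/seteqP; split => x /=; rewrite mul1r mulN1r oppr_gt0 subr_gt0 subr_lt0.
  by move=> ->; rewrite ltxx => -[].
by move=> /not_orP[/negP + /negP]; rewrite -!leNgt => h1 h2; apply/eqP; rewrite eq_le h1 h2.
Qed.

(** * A weak type inequality for weighted cells *)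

Section step_functions.
Context d (T : measurableType d) (R : realType).
Variables (F : nat -> set T) (v : nat -> R) (P : pred nat).
Hypothesis mF : forall k, measurable (F k).
Hypothesis disjF : forall k l y, P k -> P l -> F k y -> F l y -> k = l.

(** The sum over [P] of [v k] times the indicator of [F k]: by [disjF] the chosen index is the only
    one. *)
Definition step_fun (y : T) : R :=
  if pselect (exists k, P k /\ F k y) is left h then v (sval (cid h)) else 0.

Lemma step_funE k y : P k -> F k y -> step_fun y = v k.
Proof.
move=> Pk Fky; rewrite /step_fun; case: pselect => [h|[]]; last by exists k.
by case: (cid h) => l [Pl Fly] /=; rewrite (disjF Pk Pl Fky Fly).
Qed.

Lemma step_fun0 y : (forall k, P k -> ~ F k y) -> step_fun y = 0.
Proof.
by move=> h; rewrite /step_fun; case: pselect => // -[k [Pk Fk]]; case: (h k Pk).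
Qed.

Lemma measurable_step_fun : measurable_fun setT step_fun.
Proof.
move=> _ Y mY; rewrite setTI.
rewrite (_ : step_fun @^-1` Y =
  \bigcup_(k in [set k | P k /\ Y (v k)]) F k `|`
  (if `[< Y 0 >] then ~` \bigcup_(k in [set k | P k]) F k else set0)).
  apply: measurableU; first by apply: bigcup_measurable.
  by case: ifP => // _; apply: measurableC; apply: bigcup_measurable.
apply/seteqP; split => y /=.
  have [[k [Pk Fk]]|h] := pselect (exists k, P k /\ F k y).
    by rewrite (step_funE Pk Fk) => Yv; left; exists k.
  rewrite step_fun0 => [Y0|k Pk Fk]; last by apply: h; exists k.
  by right; rewrite asboolT// => -[k Pk Fk]; apply: h; exists k.
move=> [[k [Pk Yv] Fk]|]; first by rewrite (step_funE Pk Fk).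
case: ifPn => // /asboolP Y0 h; rewrite step_fun0// => k Pk Fk.
by apply: h; exists k.
Qed.

Local Open Scope ereal_scope.

(** The function [h] lets one formula serve both for the [n]-th power in the norm and for the
    absolute value in the average over a tube. *)
Lemma integral_step_fun (mu : {measure set T -> \bar R}) (Q : pred nat) (h : R -> R) :
  measurable_fun setT h -> (forall r, 0 <= h r)%R -> (forall k, Q k -> P k) ->
  \int[mu]_(y in \bigcup_(k in [set k | Q k]) F k) (h (step_fun y))%:E =
  \sum_(k <oo | Q k) (h (v k))%:E * mu (F k).
Proof.
move=> mh h0 QP.
have mhf D : measurable_fun D (EFin \o (h \o step_fun)).
  apply/measurable_EFinP; apply: measurable_funTS.
  exact: measurableT_comp mh measurable_step_fun.
pose F' k := if Q k then F k else set0.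
have -> : \bigcup_(k in [set k | Q k]) F k = \bigcup_k F' k.
  rewrite bigcup_mkcond; apply: eq_bigcupr => k _.
  by rewrite /F' mem_setE.
rewrite ge0_integral_bigcup//.
- rewrite [RHS]eseries_mkcond; apply: eq_eseriesr => k _; rewrite /F'.
  case: ifPn => [Qk|_]; last by rewrite integral_set0.
  rewrite (eq_integral (cst (h (v k))%:E)); first by rewrite integral_cst.
  by move=> y /set_mem Fy; rewrite (step_funE (QP _ Qk) Fy).
- by move=> k; rewrite /F'; case: ifP.
- by move=> y _; rewrite lee_fin.
- move=> k l _ _ [y []]; rewrite /F'; case: ifPn => // /QP Pk Fk.
  by case: ifPn => // /QP Pl Fl; exact: disjF Pk Pl Fk Fl.
Qed.

End step_functions.

Section weak_type.
Context {R : realType} {n : nat}.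
Local Notation E := (euclid R n).
Hypothesis n_gt0 : (0 < n)%N.
Variables (eps C : R).
Hypothesis maximal_bound : forall delta : R, 0 < delta < 1 ->
  forall f : lebesgueT R n -> R, f \in Lfun (lebesgue R n) n%:R%:E ->
  ('N[surface]_n%:R%:E[(kakeya_maximal delta f : surfaceT -> \bar R) \_ usphere]
    <= (C * delta `^ (- eps))%:E * 'N[lebesgue R n]_n%:R%:E[EFin \o f])%E.

(* A cell of this mesh has Euclidean diameter at most [delta / 6]. *)
Definition mesh (delta : R) : R := delta / (6 * n%:R).

(** The factors come from the volume [(r / 2) ^ n] of a smaller cube in a cell, from the volume of a
    tube, and from the mesh [r = delta / (6 * n)]. *)
Definition weak_const : R := 
  (`|C| * ((12 * n%:R) ^+ n * (3 * 6 ^+ n)) / (6 * n%:R)) ^+ n.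

Local Open Scope ereal_scope.

(** Chebyshev's inequality combined with the maximal inequality for the step function with value
    [v k] on the [k]-th cell, whose norm has [n]-th power at most [r ^ n * W]. *)
Lemma kakeya_weak_type (delta t W : R) (x : nat -> E) (v : nat -> R)
    (P : pred nat) (S : set E) :
  (0 < delta < 1)%R -> (0 < t)%R -> (forall k, 0 <= v k)%R ->
  (forall k l y, P k -> P l -> cell (mesh delta) (x k) y ->
    cell (mesh delta) (x l) y -> k = l) ->
  \sum_(k <oo | P k) (v k ^+ n)%:E <= W%:E ->
  S `<=` usphere ->
  (forall e, S e -> exists y, t%:E <= \sum_(k <oo |
     P k && `[< cell (mesh delta) (x k) `<=` tube (delta / 3) e y >]) (v k)%:E) ->
  surface_outer S <= (weak_const * (delta `^ (- eps) / t) ^+ n * W)%:E.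
Proof.
move=> d01 t0 v0 disj vW S1 St.
have /andP[d0 d1] := d01.
have nR : (0 < n%:R :> R)%R by rewrite ltr0n.
set r := mesh delta.
have r0 : (0 < r)%R by rewrite divr_gt0// mulr_gt0.
pose F k : set (lebesgueT R n) := cell r (x k).
have mF k : measurable (F k) by exact: cell_measurable.
pose f : lebesgueT R n -> R := step_fun F v P.
have mf : measurable_fun setT f by exact: measurable_step_fun.
have W0 : (0 <= W)%R.
  by rewrite -lee_fin; apply: le_trans vW; apply: nneseries_ge0 => k _ _; rewrite lee_fin exprn_ge0.
have nE (z : R) : (0 <= z)%R -> (z `^ n%:R = z ^+ n)%R by move=> z0; rewrite powR_mulrn.
have fnorm : \int[lebesgue R n]_y (`|f y| `^ n%:R)%:E <= (r ^+ n * W)%:E.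
  rewrite (_ : \int[_]_y _ = \int[lebesgue R n]_(y in \bigcup_(k in [set k | P k]) F k)
      (`|f y| `^ n%:R)%:E); last first.
    rewrite [RHS]integral_mkcond; apply: eq_integral => y _; rewrite patchE.
    case: ifPn => // /negP/negP; rewrite notin_setE => h.
    rewrite /f step_fun0 ?normr0 ?powR0 ?gt_eqF//.
    by move=> k Pk Fk; apply: h; exists k.
  have mh : measurable_fun setT (fun z : R => (`|z| `^ n%:R)%R).
    exact: (measurableT_comp (measurable_powR n%:R) (@normr_measurable R setT)).
  rewrite (integral_step_fun v mF disj _ mh) //.
  apply: (@le_trans _ _ (\sum_(k <oo | P k) (r ^+ n)%:E * (v k ^+ n)%:E)).
    apply: lee_nneseries => k _; first by move=> _; rewrite mule_ge0// lee_fin powR_ge0.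
    rewrite ger0_norm// nE// muleC; apply: lee_wpmul2r; rewrite ?lee_fin ?exprn_ge0//.
    exact: lebesgue_cell_le.
  rewrite nneseriesZl; last by move=> k _; rewrite lee_fin exprn_ge0.
  by rewrite EFinM lee_wpmul2l// lee_fin exprn_ge0// ltW.
have Lf : f \in Lfun (lebesgue R n) n%:R%:E.
  rewrite inE; apply/andP; split; rewrite inE//=.
  rewrite /finite_norm unlock poweR_lty//.
  exact: le_lt_trans fnorm (ltry _).
(* Lower bound for the maximal function: the weight [t] times the least cell volume [(r / 2) ^ n],
   over the largest tube volume [3 * 6 ^ n * delta ^ n / delta]. *)
pose c := (t * delta / ((12 * n%:R) ^+ n * (3 * 6 ^+ n)))%R.
have c0 : (0 < c)%R.
  by rewrite divr_gt0// mulr_gt0// ?exprn_gt0// mulr_gt0.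
(* [S] may be nonmeasurable and is enlarged to a measurable set. A [delta]-tube in a direction of
   [G] contains the [delta / 3]-tube of a nearby direction of [S], by [tube_perturb]. *)
pose G : set E := [set e' | exists2 e, S e & (mdist e' e < delta / 3)%R] `&` usphere.
have SG : S `<=` G.
  by move=> e Se; split; [exists e => //; rewrite mdistxx divr_gt0|exact: S1].
have mG : measurable (G : set (@surfaceT R n)).
  apply: measurableI; last exact: usphere_measurable.
  exact: hausdorff_neighborhood_measurable.
have maxG e' : G e' -> c%:E <= kakeya_maximal delta f e'.
  move=> [[e Se ee'] e'1].
  have [y ty] := St _ Se.
  apply: le_trans; last by apply: ereal_sup_ubound; exists y.
  pose Q k := P k && `[< F k `<=` tube (delta / 3) e y >].
  have {}ty : t%:E <= \sum_(k <oo | Q k) (v k)%:E := ty.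
  have QT : \bigcup_(k in [set k | Q k]) F k `<=` tube delta e' y.
    move=> z [k /= /andP[Pk /asboolP Qk] Fk].
    have -> : delta = (3 * (delta / 3))%R by field.
    apply: (@tube_perturb _ _ _ e) => //.
    - exact: S1.
    - by rewrite metric_sym ltW.
    - by rewrite divr_gt0.
    - exact: Qk.
  have intT : (t * (r / 2) ^+ n)%:E <=
      \int[lebesgue R n]_(z in tube delta e' y) `|f z|%:E.
    apply: le_trans (ge0_subset_integralT _ QT _); last by move=> z; rewrite lee_fin.
    rewrite (integral_step_fun v mF disj _ (@normr_measurable R setT)) //; last first.
      by move=> k /andP[].
    apply: (@le_trans _ _ (\sum_(k <oo | Q k) ((r / 2) ^+ n)%:E * (v k)%:E)).
      rewrite nneseriesZl; last by move=> k _; rewrite lee_fin.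
      by rewrite mulrC EFinM lee_wpmul2l// lee_fin exprn_ge0// divr_ge0// ltW.
    apply: lee_nneseries => k _.
      by move=> _; rewrite mule_ge0// lee_fin// exprn_ge0// divr_ge0// ltW.
    rewrite ger0_norm// muleC lee_wpmul2l ?lee_fin//.
    exact: lebesgue_cell_ge.
  have -> : c%:E = ((3 * 6 ^+ n * delta ^+ n / delta)^-1)%:E * (t * (r / 2) ^+ n)%:E.
    rewrite -EFinM; congr EFin; rewrite /c /r /mesh.
    have -> : (delta / (6 * n%:R) / 2 = delta / (12 * n%:R))%R.
      by field; rewrite gt_eqF.
    rewrite [in RHS]exprMn exprVn; field.
    by rewrite !expf_neq0 ?gt_eqF ?mulr_gt0.
  apply: lee_pmul => //.
  - by rewrite lee_fin invr_ge0 divr_ge0 ?mulr_ge0 ?exprn_ge0// ltW.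
  - by rewrite lee_fin mulr_ge0 ?exprn_ge0 ?divr_ge0// ltW.
  have K0 : (0 < 3 * 6 ^+ n * delta ^+ n / delta)%R.
    by rewrite divr_gt0 ?mulr_gt0 ?exprn_gt0.
  have -> : ((3 * 6 ^+ n * delta ^+ n / delta)^-1)%:E =
      (3 * 6 ^+ n * delta ^+ n / delta)%:E^-1 :> \bar R by rewrite inver gt_eqF.
  rewrite lee_pV2 ?inE ?lee_fin ?(ltW K0) ?outer_measure_ge0//.
  exact: lebesgue_tube_le.
(* Chebyshev on [G], then the maximal inequality raised to the power [n]; [C] may be negative, hence
   its absolute value. *)
have key : (c ^+ n)%:E * surface_outer S <=
    ((`|C| * delta `^ (- eps)) ^+ n * (r ^+ n * W))%:E.
  apply: (@le_trans _ _ ((c ^+ n)%:E * @surface R n G)).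
    by apply: lee_wpmul2l; [rewrite lee_fin exprn_ge0// ltW|exact: le_outer_measure].
  pose g : @surfaceT R n -> \bar R := (kakeya_maximal delta f) \_ usphere.
  have g0 e' : 0 <= g e'.
    apply: erestrict_ge0 => z _; apply: le_trans; last by apply: ereal_sup_ubound; exists 0%R.
    by rewrite mule_ge0 ?inve_ge0 ?outer_measure_ge0// integral_ge0// => u _; rewrite lee_fin.
  apply: (@le_trans _ _ ('N[@surface R n]_n%:R%:E[g] `^ n%:R)).
    rewrite poweR_Lnorm ?gt_eqF//; apply: integral_ge_cst => //.
    - by rewrite exprn_ge0// ltW.
    - by move=> z; exact: poweR_ge0.
    move=> z Gz; rewrite gee0_abs// -nE ?(ltW c0)// -poweR_EFin.
    rewrite gt0_ler_poweR ?in_itv/= ?lee_fin ?(ltW c0) ?leey ?andbT//.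
    by rewrite /g patchE mem_set; [exact: maxG|case: Gz].
  apply: (@le_trans _ _ (((`|C| * delta `^ (- eps))%:E *
      'N[lebesgue R n]_n%:R%:E[EFin \o f]) `^ n%:R)).
    rewrite gt0_ler_poweR ?in_itv/= ?leey ?andbT ?Lnorm_ge0 ?mule_ge0 ?Lnorm_ge0
      ?lee_fin ?mulr_ge0 ?powR_ge0//.
    apply: le_trans (maximal_bound d01 Lf) _; apply: lee_wpmul2r; first exact: Lnorm_ge0.
    by rewrite lee_fin ler_wpM2r ?powR_ge0// ler_norm.
  rewrite poweRM ?Lnorm_ge0 ?lee_fin ?mulr_ge0 ?powR_ge0// poweR_EFin nE ?mulr_ge0 ?powR_ge0//.
  rewrite EFinM lee_wpmul2l ?lee_fin ?exprn_ge0 ?mulr_ge0 ?powR_ge0//.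
  by rewrite poweR_Lnorm ?gt_eqF.
have cn0 : (0 < c ^+ n)%R by rewrite exprn_gt0.
rewrite -lee_pdivlMl// in key; apply: le_trans key _.
rewrite -EFinM lee_fin le_eqVlt; apply/orP; left; apply/eqP.
rewrite /weak_const -exprVn -[in RHS]exprMn.
transitivity ((c^-1 * (`|C| * delta `^ (- eps) * r)) ^+ n * W)%R.
  by rewrite !exprMn; ring.
congr (_ ^+ _ * _)%R; rewrite /c /r /mesh; field.
by rewrite !expf_neq0 ?gt_eqF ?mulr_gt0.
Qed.

End weak_type.

(** * Quasisymmetric images of segments *)

Section interval_covers.
Context {R : realType}.
Variables (D : R) (b c w : nat -> R) (Q : nat -> pred nat).
Hypothesis w_ge0 : forall k, 0 <= w k.
Hypothesis cover_D : forall s, 0 <= s <= D -> (exists k, s = b k) \/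
  exists j k, Q j k /\ `|s - c k| <= w k.

Let lebesgue_measure_cc (p q : R) : p <= q ->
  lebesgue_measure (`[p, q]%classic : set R) = (q - p)%:E.
Proof.
rewrite lebesgue_measure_itv/= lte_fin le_eqVlt => /predU1P[->|->].
  by rewrite ltxx subrr.
by rewrite EFinB.
Qed.

(** The points [b k] form a null set, so the intervals of length [2 * w k] must carry the whole
    length [D]. *)
Lemma interval_cover_le : 0 <= D ->
  (D%:E <= \sum_(j <oo) \sum_(k <oo | Q j k) (2 * w k)%:E)%E.
Proof.
move=> D0; pose I k : set R := `[c k - w k, c k + w k]%classic.
have Ik k : lebesgue_measure (I k) = (2 * w k)%:E.
  rewrite lebesgue_measure_cc; first by congr EFin; ring.
  by have := w_ge0 k; lra.
pose J j : set R := \bigcup_(k in [set k | Q j k]) I k.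
have mJ j : measurable (J j).
  by apply: bigcup_measurable => k _; exact: measurable_itv.
have Jle j : (lebesgue_measure (J j) <= \sum_(k <oo | Q j k) (2 * w k)%:E)%E.
  rewrite [leRHS]eseries_mkcond.
  pose I' k := if Q j k then I k else set0.
  have mI' k : measurable (I' k).
    by rewrite /I'; case: ifP => _; [exact: measurable_itv|exact: measurable0].
  apply: le_trans (measure_sigma_subadditive lebesgue_measure mI' (mJ j) _) _.
    by move=> s [k /= Qk Is]; exists k => //; rewrite /I' Qk.
  apply: lee_nneseries => k _; first by move=> _; exact: measure_ge0.
  by rewrite /I'; case: ifP => _; rewrite ?measure0// -Ik.
have cb : countable (range b).
  exact: sub_countable (card_image_le b [set: nat]) (countableP _).
have mb : measurable (range b) by exact: countable_measurable cb.
have b0 : lebesgue_measure (range b) = 0 by exact: countable_lebesgue_measure0.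
pose F j := if j is j'.+1 then J j' else range b.
have mF j : measurable (F j) by case: j.
have DF : `[0, D]%classic `<=` \bigcup_j F j.
  move=> s /=; rewrite in_itv/= => /cover_D[[k ->]|[j [k [Qk sk]]]].
    by exists 0%N => //; exists k.
  exists j.+1 => //; exists k => //; rewrite /I/= in_itv/=.
  by move: sk; rewrite ler_norml => /andP[s1 s2]; apply/andP; split; lra.
have : (lebesgue_measure (`[0%R, D]%classic : set R) <=
    \sum_(j <oo) lebesgue_measure (F j))%E.
  by apply: measure_sigma_subadditive => //; exact: measurable_itv.
rewrite lebesgue_measure_cc// subr0 => /le_trans; apply.
rewrite nneseries_recl//= b0 add0e.
rewrite -nneseries_addn//; apply: lee_nneseries => j _.
  by move=> _; exact: measure_ge0.
by rewrite addn1; exact: Jle.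
Qed.

(** If every class [j] had total length below [D * u j], the sum over the classes would stay below
    [D]. *)
Lemma interval_cover_pigeonhole (u : nat -> R) : 0 < D -> (forall j, 0 <= u j) ->
  (\sum_(j <oo) (u j)%:E < 1)%E ->
  exists j, ((D * u j)%:E <= \sum_(k <oo | Q j k) (2 * w k)%:E)%E.
Proof.
move=> D0 u0 u1; apply: contrapT => /forallNP h.
have := interval_cover_le (ltW D0); rewrite leNgt => /negP; apply.
apply: (@le_lt_trans _ _ (\sum_(j <oo) D%:E * (u j)%:E)%E).
  apply: lee_nneseries => j _.
    by move=> _; apply: nneseries_ge0 => k _ _; rewrite lee_fin mulr_ge0.
  by rewrite ltW// -EFinM ltNge; apply/negP/h.
rewrite nneseriesZl; last by move=> j _; rewrite lee_fin.
by rewrite -[ltRHS]mule1 lte_pmul2l.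
Qed.

End interval_covers.

(** * Distortion of a map along a unit segment *)

Section quasisymmetric_segments.
Context {R : realType} {n : nat} {Y : metricType R}.
Local Notation E := (euclid R n).
Variables (K : set E) (g : E -> Y) (eta : R -> R).
Hypothesis eta_ge0 : forall t, 0 <= t -> 0 <= eta t.
Hypothesis eta_le : forall s t, 0 <= s -> s <= t -> eta s <= eta t.
Hypothesis qs : forall x y z, K x -> K y -> K z -> x != z ->
  mdist (g x) (g y) <= eta (mdist x y / mdist x z) * mdist (g x) (g z).

Lemma qs_le (t : R) x y z : K x -> K y -> K z -> x != z ->
  mdist x y <= t * mdist x z ->
  mdist (g x) (g y) <= eta t * mdist (g x) (g z).
Proof.
move=> Kx Ky Kz xz xyz; apply: le_trans (qs Kx Ky Kz xz) _.
rewrite ler_wpM2r ?mdist_ge0// eta_le ?divr_ge0 ?mdist_ge0//.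
by rewrite ler_pdivrMr// mdist_gt0.
Qed.

Variables (a e : E) (N : R) (m : nat).
Hypothesis e1 : usphere e.
Hypothesis segK : unit_segment e a `<=` K.
Local Notation D := (mdist (g a) (g (a + e))).
Hypothesis D_le : D <= N.
Hypothesis eta_half : eta (2^-1 ^+ m) <= 2^-1.

Let pt t : E := a + t *: e.

Let Kpt t : 0 <= t <= 1 -> K (pt t).
Proof. by move=> t01; apply: segK; exists t => //=; rewrite in_itv. Qed.

Let pt_dist t u : mdist (pt t) (pt u) = `|t - u|.
Proof. exact: segment_mdist. Qed.

Let pt_neq t u : t != u -> pt t != pt u.
Proof. by rewrite -mdist_gt0 pt_dist normr_gt0 subr_eq0. Qed.

Let pt0 : pt 0 = a. Proof. by rewrite /pt scale0r addr0. Qed.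
Let pt1 : pt 1 = a + e. Proof. by rewrite /pt scale1r. Qed.

(** The endpoint farther from [pt t] is chosen; comparison with the full segment, seen from that
    endpoint, costs the factor [eta 1]. *)
Let far_endpoint t : 0 <= t <= 1 -> exists b,
  [/\ 0 <= b <= 1, 2^-1 <= `|b - t| & mdist (g (pt t)) (g (pt b)) <= eta 1 * N].
Proof.
move=> t01; have [th|th] := leP 2^-1 t.
  exists 0; split; first by rewrite lexx ler01.
    by rewrite sub0r normrN ger0_norm//; lra.
  rewrite metric_sym; apply: (@le_trans _ _ (eta 1 * mdist (g (pt 0)) (g (pt 1)))).
    apply: qs_le; rewrite ?pt_dist; [by apply: Kpt; lra|exact: Kpt|by apply: Kpt; lra| |].
      by apply: pt_neq; rewrite eq_sym oner_eq0.
    by rewrite !sub0r !normrN normr1 ger0_norm; lra.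
  by rewrite pt0 pt1 ler_wpM2l// eta_ge0.
exists 1; split; first by rewrite ler01 lexx.
  by rewrite ger0_norm; lra.
rewrite metric_sym; apply: (@le_trans _ _ (eta 1 * mdist (g (pt 1)) (g (pt 0)))).
  apply: qs_le; rewrite ?pt_dist; [by apply: Kpt; lra|exact: Kpt|by apply: Kpt; lra| |].
    by apply: pt_neq; rewrite oner_eq0.
  by rewrite subr0 normr1 ger0_norm; lra.
by rewrite pt0 pt1 metric_sym ler_wpM2l// eta_ge0.
Qed.

Let lam : R := 2^-1 ^+ m.

Let lam01 : 0 < lam <= 1.
Proof. by rewrite exprn_gt0//= exprn_ile1//; lra. Qed.

(** Contracting towards [x] by the factor [lam] halves the distance of the images, since
    [eta lam <= 1 / 2]. Iterating from a far endpoint gives points [z k], and [y] is no farther from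
    [x] than [z i], which costs one more [eta 1]. *)
Lemma qs_segment_holder x y i : unit_segment e a x -> K y ->
  mdist x y <= lam ^+ i / 2 ->
  mdist (g x) (g y) <= eta 1 ^+ 2 * N * 2^-1 ^+ i.
Proof.
move=> [t /= + <-] Ky; rewrite in_itv/= => t01; rewrite -/(pt t).
have [b [b01 bt hb]] := far_endpoint t01.
have /andP[l0 l1] := lam01.
pose z k := pt (t + lam ^+ k * (b - t)).
have lk k : 0 < lam ^+ k <= 1 by rewrite exprn_gt0//= exprn_ile1// ltW.
have Kz k : K (z k).
  apply: Kpt; have := lk k; move: (lam ^+ k) => l hl; apply/andP; split; nra.
have zdist k : mdist (pt t) (z k) = lam ^+ k * `|b - t|.
  rewrite pt_dist opprD addrA subrr sub0r normrN normrM ger0_norm//.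
  by case/andP: (lk k) => /ltW.
have zne k : pt t != z k.
  rewrite -mdist_gt0 zdist mulr_gt0 ?exprn_gt0//.
  by apply: lt_le_trans bt; lra.
have hz k : mdist (g (pt t)) (g (z k)) <= eta 1 * N * 2^-1 ^+ k.
  elim: k => [|k IH].
    by rewrite expr0 mulr1 /z expr0 mul1r addrC subrK.
  apply: (@le_trans _ _ (eta lam * mdist (g (pt t)) (g (z k)))).
    apply: qs_le => //; first exact: Kpt.
    by rewrite !zdist exprS mulrA.
  rewrite exprS mulrCA; apply: ler_pM => //; first by apply: eta_ge0; exact: ltW.
  exact: mdist_ge0.
move=> xy; apply: (@le_trans _ _ (eta 1 * mdist (g (pt t)) (g (z i)))).
  apply: qs_le => //; first exact: Kpt.
  rewrite mul1r zdist; apply: le_trans xy _.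
  by rewrite ler_wpM2l//; case/andP: (lk i) => /ltW.
by rewrite expr2 -!mulrA ler_wpM2l// ?eta_ge0// mulrA hz.
Qed.

(** If [y] were farther than [r] from [x], the images of both endpoints would be within
    [eta r^-1 * mdist (g x) (g y)] of [g x], making [D] too small. *)
Lemma qs_segment_small x y r : unit_segment e a x -> K y -> 0 < r ->
  2 * eta r^-1 * mdist (g x) (g y) < D -> mdist x y <= r.
Proof.
move=> [t /= + <-] Ky r0; rewrite in_itv/= => t01; rewrite -/(pt t).
apply: contraTT; rewrite -!leNgt -ltNge => xy.
have xney : pt t != y by rewrite -mdist_gt0 (lt_trans r0).
have h u : 0 <= u <= 1 -> mdist (g (pt t)) (g (pt u)) <= eta r^-1 * mdist (g (pt t)) (g y).
  move=> u01; apply: qs_le => //; [exact: Kpt|exact: Kpt|].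
  rewrite mulrC ler_pdivlMr// pt_dist.
  apply: le_trans (ltW xy); rewrite -[leRHS]mul1r ler_wpM2r// ?(ltW r0)//.
  by rewrite ler_norml; lra.
have -> : D = mdist (g (pt 0)) (g (pt 1)) by rewrite pt0 pt1.
apply: le_trans (metric_triangle _ (g (pt t)) _) _.
rewrite [X in X + _]metric_sym.
have h0 := h 0; have h1 := h 1; rewrite !lexx !ler01 /= in h0 h1.
have {}h0 := h0 isT; have {}h1 := h1 isT.
by lra.
Qed.

(** Intermediate values: the decay in [qs_segment_holder] makes the distance to [g a] continuous
    along the segment. *)
Lemma qs_segment_onto s : 0 <= s <= D -> exists2 x, unit_segment e a x &
  s = mdist (g a) (g x).
Proof.
move=> sD; pose phi t := mdist (g a) (g (pt t)).
have phi_cont : {within `[0, 1], continuous phi}.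
  apply/subspace_continuousP => t /= t01; rewrite in_itv/= in t01.
  apply/cvgrPdist_le => eps eps0.
  have C0 : 0 <= eta 1 ^+ 2 * N.
    by rewrite mulr_ge0 ?sqr_ge0// (le_trans _ D_le)// mdist_ge0.
  have [i hi] : exists i, eta 1 ^+ 2 * N * 2^-1 ^+ i <= eps.
    exists (Num.bound (eta 1 ^+ 2 * N / eps)).
    rewrite exprVn ler_pdivrMr ?exprn_gt0// [leRHS]mulrC -ler_pdivrMr//.
    by apply: ltW; exact: upper_nthrootP.
  near=> u.
  have u01 : 0 <= u <= 1.
    have : `[0, 1]%classic u by near: u; exact: near_withinT.
    by rewrite /= in_itv.
  have tu : `|t - u| <= lam ^+ i / 2.
    near: u; rewrite near_withinE.
    have li0 : 0 < lam ^+ i / 2 by rewrite divr_gt0// exprn_gt0//; case/andP: lam01.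
    have := @cvgrPdist_le _ _ _ (nbhs t) _ id t => -[/(_ (@cvg_id _ _))/(_ _ li0) + _].
    by apply: filterS => u tu _.
  apply: le_trans hi.
  apply: (@le_trans _ _ (mdist (g (pt t)) (g (pt u)))); last first.
    apply: qs_segment_holder; last by rewrite pt_dist.
      by exists t => //=; rewrite in_itv.
    exact: Kpt.
  have h1 := metric_triangle (g a) (g (pt t)) (g (pt u)).
  have h2 := metric_triangle (g a) (g (pt u)) (g (pt t)).
  rewrite (metric_sym (g (pt u))) in h2.
  by rewrite /from_subspace/= /phi ler_norml; apply/andP; split; lra.
have [||t t01 ts] := @IVT R phi 0 1 s _ phi_cont; first exact: ler01.
  by rewrite /phi pt0 pt1 mdistxx min_l ?max_r ?mdist_ge0.
by exists (pt t); [exists t|].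
Unshelve. all: by end_near. Qed.

End quasisymmetric_segments.

(** * Directions of segments with a small image *)

Lemma geometric_nneseries_le (R : realType) (q : R) : 0 <= q < 1 ->
  (\sum_(j <oo) (q ^+ j.+1)%:E <= (q / (1 - q))%:E)%E.
Proof.
move=> /andP[q0 q1]; apply: lime_le.
  by apply: is_cvg_nneseries => j _ _; rewrite lee_fin exprn_ge0.
apply: nearW => N; rewrite sumEFin lee_fin ler_pdivlMr ?subr_gt0//.
have -> : (\sum_(0 <= j < N) q ^+ j.+1) * (1 - q) = q - q ^+ N.+1.
  elim: N => [|N IH]; first by rewrite big_geq// mul0r expr1 subrr.
  by rewrite big_nat_recr//= mulrDl IH (exprS _ N.+1); ring.
by rewrite gerBl exprn_ge0.
Qed.

(** The largest [j] whose ball still contains [U] is taken: [j = 0] works by hypothesis, [y] bounds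
    [j], and failure at [j + 1] gives [z]. *)
Lemma dyadic_radius (R : realType) (T : metricType R) (U : set T) (x y : T) :
  x != y -> U x -> U y -> (forall z, U z -> mdist x z <= 12^-1) ->
  exists z j, [/\ U z, forall z', U z' -> mdist x z' <= 2^-1 ^+ j.+1 / 6 &
    2^-1 ^+ j.+1 / 12 < mdist x z].
Proof.
move=> xy Ux Uy Ux12.
pose inball j := `[< forall z, U z -> mdist x z <= 2^-1 ^+ j.+1 / 6 >].
have b0 : exists j, inball j.
  by exists 0%N; apply/asboolP => z /Ux12 /le_trans; apply; rewrite expr1; lra.
have xy0 : 0 < mdist x y by rewrite mdist_gt0.
have bmax j : inball j -> (j <= Num.bound (mdist x y)^-1)%N.
  move=> /asboolP/(_ _ Uy) h; rewrite leqNgt; apply/negP => jb.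
  have : (mdist x y)^-1 < 2 ^+ j.+1 by apply: upper_nthrootP; rewrite ltnW// ltnW.
  rewrite -[ltRHS]invrK -exprVn ltf_pV2 ?posrE ?exprn_gt0//.
  by have : 0 < 2^-1 ^+ j.+1 :> R by [rewrite exprn_gt0]; lra.
have [j /asboolP inj jmax] := ex_maxnP b0 bmax.
have : ~ (forall z, U z -> mdist x z <= 2^-1 ^+ j.+2 / 6).
  by move=> h; have := jmax j.+1 (asboolT h); rewrite ltnn.
move=> /existsNP[z /not_implyP[Uz /negP]]; rewrite -ltNge => hz.
exists z, j; split => //; apply: le_lt_trans hz.
by rewrite (exprS _ j.+1); lra.
Qed.

Lemma hausdorff_null_cover (R : realType) (Y : metricType R) (s d eps : R) (A : set Y) :
  0 < d -> 0 < eps -> hausdorff_outer s A = 0%E ->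
  exists (P : pred nat) (V : nat -> set Y),
  [/\ forall k, P k -> (diameter (V k) <= d%:E)%E,
      forall y, A y -> exists2 k, P k & V k y &
      (\sum_(k <oo | P k) diameter (V k) `^ s <= eps%:E)%E].
Proof.
move=> d0 eps0 sA.
have c0 : hausdorff_content s d A = 0%E.
  apply/eqP; rewrite eq_le -{1}sA hausdorff_content_le_outer//=.
  by apply: cover_outer_ge0 => U _; exact: poweR_ge0.
have fc : hausdorff_content s d A \is a fin_num by rewrite c0.
have [_ [D [cD Dd AD] <-]] := lb_ereal_inf_adherent eps0 fc.
move=> De; have {}De : (\esum_(U in D) diameter U `^ s <
    hausdorff_content s d A + eps%:E)%E := De.
rewrite c0 add0e in De.
have [P [V VD]] := countable_enum cD.
have [VPD _ Vsurj] := VD.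
exists P, V; split => [k Pk|y /AD[U /Vsurj[k /= Pk <-] Vy]|].
- exact/Dd/VPD.
- by exists k.
rewrite nneseries_esum; last by move=> k _; exact: poweR_ge0.
by apply: le_trans (ltW De); rewrite (reindex_esum _ _ _ (fun U => diameter U `^ s)%E VD).
Qed.

Section null_directions.
Context {R : realType} {n : nat} {Y : metricType R}.
Local Notation E := (euclid R n).
Hypothesis n_gt0 : (0 < n)%N.
Variables (K : set E) (g : E -> Y) (eta : R -> R) (m : nat) (s : R).
Hypothesis eta_gt0 : forall t, 0 < t -> 0 < eta t.
Hypothesis eta_ge0 : forall t, 0 <= t -> 0 <= eta t.
Hypothesis eta_le : forall t u, 0 <= t -> t <= u -> eta t <= eta u.
Hypothesis m_gt0 : (0 < m)%N.
Hypothesis eta_half : eta (2^-1 ^+ m) <= 2^-1.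
Hypothesis qs : forall x y z, K x -> K y -> K z -> x != z ->
  mdist (g x) (g y) <= eta (mdist x y / mdist x z) * mdist (g x) (g z).
Hypothesis s_ge0 : 0 <= s.
Hypothesis s_ltn : s < n%:R.
Hypothesis gK0 : hausdorff_outer s (g @` K) = 0%E.
Variables (S : set E) (a : E -> E) (N d : R).
Hypothesis S_sphere : S `<=` usphere.
Hypothesis segK : forall e, S e -> unit_segment e (a e) `<=` K.
Hypothesis N_gt0 : 0 < N.
Hypothesis d_gt0 : 0 < d.
Hypothesis D_bounds : forall e, S e -> d <= mdist (g (a e)) (g (a e + e)) <= N.

Let gam : R := n%:R - s.
(* With this [eps] the Hoelder decay [2 ^ (- j * gam / m)] of the weights at scale
   [2 ^ (- j)] is [q ^ ((2 n + 1) j)], and only [q ^ (- 2 n j)] is lost. *)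
Let eps : R := gam / ((2 * n).+1%:R * m%:R).
Let q : R := 2 `^ (- eps).
Let dl j : R := 2^-1 ^+ j.+1.
Let B : R := eta 1 ^+ 2 * N.

Let gam_gt0 : 0 < gam. Proof. by rewrite subr_gt0. Qed.

Let eps_gt0 : 0 < eps.
Proof. by rewrite divr_gt0// mulr_gt0 ?ltr0n. Qed.

Let q01 : 0 < q < 1.
Proof.
have le1 : q <= 1.
  rewrite -(@powRr0 R 2) /q ler_powR ?ler1n// oppr_le0; exact: ltW.
rewrite powR_gt0//= lt_neqAle le1 andbT /q powR_eq1 oppr_eq0 (gt_eqF eps_gt0).
by rewrite orbF negb_or -leNgt ler0n andbT pnatr_eq1.
Qed.

Let dl01 j : 0 < dl j < 1.
Proof. by rewrite exprn_gt0//= exprn_ilt1//; lra. Qed.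

Let dl_powR j : dl j `^ (- eps) = (q ^+ j.+1)^-1.
Proof.
have -> : dl j = 2 `^ (- j.+1%:R) by rewrite powRN powR_mulrn// /dl exprVn.
by rewrite /q -powR_mulrn ?powR_ge0// -!powRrM -powRN; congr powR; ring.
Qed.

(** Rounding the quotient down loses at most one in the exponent, which accounts for [2 ^ gam]; the
    rest is the choice of [eps]. *)
Let holder_powR j : (2^-1 ^+ (j.+1 %/ m)) `^ gam <= 2 `^ gam * q ^+ ((2 * n).+1 * j.+1).
Proof.
rewrite -[q ^+ _]powR_mulrn ?powR_ge0// /q -powRrM -powRD; last by rewrite pnatr_eq0 implybT.
rewrite exprVn -powR_mulrn// -powRN -powRrM ler_powR ?ler1n//.
have m0 : 0 < m%:R :> R by rewrite ltr0n.
have -> : - eps * ((2 * n).+1 * j.+1)%:R = - (gam * (j.+1%:R / m%:R)).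
  rewrite /eps !natrM; field.
  by rewrite gt_eqF//= pnatr_eq0.
have : j.+1%:R / m%:R <= (j.+1 %/ m)%:R + 1 :> R.
  by rewrite ler_pdivrMr// natr1 -natrM ler_nat ltnW// ltn_ceil.
by rewrite -(ler_pM2l gam_gt0); lra.
Qed.

Let segs : set E := \bigcup_(e in S) unit_segment e (a e).

Let segsK : segs `<=` K. Proof. by move=> x [e Se] /(segK Se). Qed.

(** The threshold makes [2 * eta 12] times the image distance smaller than [d], so that
    [qs_segment_small] applies with [r = 1 / 12]. *)
Let segs_small x y : segs x -> K y ->
  mdist (g x) (g y) <= d / (2 * eta 12 + 1) -> mdist x y <= 12^-1.
Proof.
move=> [e Se ex] Ky gxy.
have e12 : 0 < eta 12 by exact: eta_gt0.
apply: (@qs_segment_small _ _ _ K g eta eta_le qs (a e) e) => //.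
- exact: S_sphere.
- exact: segK.
- apply: lt_le_trans; last by have /andP[h _] := D_bounds Se; exact: h.
  rewrite invrK; apply: (@le_lt_trans _ _ (2 * eta 12 * (d / (2 * eta 12 + 1)))).
    by rewrite ler_wpM2l// mulr_ge0// ltW.
  by rewrite mulrA ltr_pdivrMr; [rewrite mulrDr mulr1 (mulrC d) ltrDl|lra].
Qed.

(** With [i = (j + 1) %/ m] the contraction [2 ^ (- m * i)] is at least [dl j]. *)
Let segs_holder x y j : segs x -> K y -> mdist x y <= dl j / 6 ->
  mdist (g x) (g y) <= B * 2^-1 ^+ (j.+1 %/ m).
Proof.
move=> [e Se ex] Ky xy.
have /andP[_ DN] := D_bounds Se.
apply: (qs_segment_holder eta_ge0 eta_le qs (S_sphere Se) (segK Se) DN eta_half ex Ky).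
apply: le_trans xy _; rewrite -exprM.
have : dl j <= 2^-1 ^+ (m * (j.+1 %/ m)).
  rewrite /dl ler_wiXn2l ?invr_ge0//; first by lra.
  by rewrite mulnC leq_trunc_div.
by have /andP[] := dl01 j; lra.
Qed.

Variable C : R.
Hypothesis maximal_bound : forall delta : R, 0 < delta < 1 ->
  forall f : lebesgueT R n -> R, f \in Lfun (lebesgue R n) n%:R%:E ->
  ('N[surface]_n%:R%:E[(kakeya_maximal delta f : surfaceT -> \bar R) \_ usphere]
    <= (C * delta `^ (- eps))%:E * 'N[lebesgue R n]_n%:R%:E[EFin \o f])%E.

(** Chosen so that the numbers [kap * q ^ (j + 1)] add up to [q / 2 < 1], as the pigeonhole
    requires. *)
Let kap : R := (1 - q) / 2.
(** The pigeonhole is applied to intervals of half-length [eta 4 * v k], hence the denominator. *)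
Let thr j : R := d * (kap * q ^+ j.+1) / (2 * eta 4).

Let total : R := @weak_const R n C * (d * kap / (2 * eta 4))^-1 ^+ n *
  (B `^ gam * 2 `^ gam) * (q / (1 - q)).

Let const_ge0 : 0 <= @weak_const R n C * (d * kap / (2 * eta 4))^-1 ^+ n *
  (B `^ gam * 2 `^ gam).
Proof.
have /andP[q0 q1] := q01.
have kap0 : 0 < kap by rewrite divr_gt0// subr_gt0.
apply: mulr_ge0; last by rewrite mulr_ge0 ?powR_ge0.
apply: mulr_ge0.
  by rewrite /weak_const exprn_ge0// divr_ge0 ?mulr_ge0// exprn_ge0// mulr_ge0.
have eta4 : 0 < eta 4 by exact: eta_gt0.
by rewrite exprn_ge0// invr_ge0 ltW// divr_gt0// mulr_gt0.
Qed.

Section one_cover.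
Variables (e0 : R) (P : pred nat) (V : nat -> set Y).
Hypothesis e0_gt0 : 0 < e0.
Hypothesis V_small : forall k, P k ->
  (diameter (V k) <= (d / (2 * eta 12 + 1))%:E)%E.
Hypothesis V_cover : forall y, (g @` K) y -> exists2 k, P k & V k y.
Hypothesis V_sum : (\sum_(k <oo | P k) diameter (V k) `^ s <= e0%:E)%E.

Let U k : set E := [set x | [/\ P k, segs x & V k (g x)]].

(** A centre, a far point and a dyadic scale comparable to the size of [U k]; the far point later
    gives the weight [v k]. *)
Let chosen k (t : E * E * nat) :=
  [/\ U k t.1.1, U k t.1.2,
      forall x, U k x -> mdist t.1.1 x <= dl t.2 / 6 &
      dl t.2 / 12 < mdist t.1.1 t.1.2].

(** A set [U k] with at most one point has no scale; such sets only produce the countably many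
    exceptional values of the pigeonhole. *)
Let trivial_or_chosen k :
  (forall x y, U k x -> U k y -> x = y) \/ exists t, chosen k t.
Proof.
have [|/existsNP[x /existsNP[y /not_implyP[Ux /not_implyP[Uy /eqP xy]]]]] :=
  pselect (forall x y, U k x -> U k y -> x = y); first by left.
right; have U12 z : U k z -> mdist x z <= 12^-1.
  move=> [Pk sz Vz]; have [_ sx Vx] := Ux; apply: segs_small => //; first exact: segsK.
  by rewrite -lee_fin; apply: le_trans (V_small Pk); exact: mdist_le_diameter.
have [z [j [Uz xball zfar]]] := dyadic_radius xy Ux Uy U12.
by exists (x, z, j).
Qed.

Let nt k : Prop := exists t, chosen k t.

Let pick : {t : nat -> E * E * nat & forall k, nt k -> chosen k (t k)}.
Proof.
apply: (@choice _ _ (fun k t => nt k -> chosen k t)) => k.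
by have [[t ht]|h] := pselect (nt k); [exists t|exists (0, 0, 0%N)].
Qed.

Let X k : E := (projT1 pick k).1.1.
Let Z k : E := (projT1 pick k).1.2.
Let J k : nat := (projT1 pick k).2.
Let v k : R := mdist (g (X k)) (g (Z k)).

Let ntP k : nt k -> [/\ U k (X k), U k (Z k),
  forall x, U k x -> mdist (X k) x <= dl (J k) / 6 &
  dl (J k) / 12 < mdist (X k) (Z k)].
Proof. exact: (projT2 pick). Qed.

Let same j k k' := [/\ nt k', J k' = j & cell (@mesh R n (dl j)) (X k') (X k)].

(* The indices of scale [j] that come first among those in the same cell. *)
Let rep j : pred nat := fun k =>
  `[< [/\ nt k, J k = j & forall k', (k' < k)%N -> ~ same j k k'] >].

Let repP k : nt k -> exists2 k', rep (J k) k' & cell (@mesh R n (dl (J k))) (X k') (X k).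
Proof.
move=> ntk; pose p k' := `[< same (J k) k k' >].
have exp : exists k', p k' by exists k; apply/asboolP; split.
case: (ex_minnP exp) => k' /asboolP[ntk' Jk' ck'] mink'.
exists k' => //; apply/asboolP; split => // l lk' [ntl Jl cl].
have : p l by apply/asboolP; split => // i; rewrite ck'; exact: cl.
by move=> /mink'; rewrite leqNgt lk'.
Qed.

Let rep_disjoint j k l y : rep j k -> rep j l ->
  cell (@mesh R n (dl j)) (X k) y -> cell (@mesh R n (dl j)) (X l) y -> k = l.
Proof.
move=> /asboolP[ntk Jk mk] /asboolP[ntl Jl ml] ky ly.
have [kl|lk|//] := ltngtP k l.
  by case: (ml k kl); split => // i; rewrite -ky -ly.
by case: (mk l lk); split => // i; rewrite -ky -ly.
Qed.

(** In [v k ^ n = v k ^ gam * v k ^ s] the first factor is small by the Hoelder decay, and the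
    second is at most the cost of [V k]. *)
Let v_sum j : (\sum_(k <oo | rep j k) (v k ^+ n)%:E <=
  (B `^ gam * (2 `^ gam * q ^+ ((2 * n).+1 * j.+1)) * e0)%:E)%E.
Proof.
have B0 : 0 < B by rewrite mulr_gt0// exprn_gt0// eta_gt0.
set w := B `^ gam * _.
have w0 : 0 <= w by rewrite mulr_ge0 ?powR_ge0// mulr_ge0 ?powR_ge0// exprn_ge0// powR_ge0.
apply: (@le_trans _ _ (\sum_(k <oo | P k) w%:E * diameter (V k) `^ s)%E); last first.
  rewrite nneseriesZl; last by move=> k _; exact: poweR_ge0.
  by rewrite [leRHS]EFinM; apply: lee_wpmul2l; rewrite ?lee_fin.
rewrite eseries_mkcond [leRHS]eseries_mkcond; apply: lee_nneseries => k _.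
  by move=> _; case: ifP => // _; rewrite lee_fin exprn_ge0// mdist_ge0.
case: ifPn => [/asboolP[ntk Jk _]|_]; last first.
  by case: ifP => // _; rewrite mule_ge0 ?lee_fin ?poweR_ge0.
have [[Pk sX VX] [_ sZ VZ] near _] := ntP ntk; rewrite Pk.
have vB : v k <= B * 2^-1 ^+ (j.+1 %/ m).
  by apply: segs_holder => //; [exact: segsK|rewrite -Jk; exact: near].
have v0 : 0 <= v k by exact: mdist_ge0.
have -> : v k ^+ n = v k `^ gam * v k `^ s.
  rewrite -powRD; first by rewrite /gam subrK powR_mulrn.
  by rewrite /gam subrK pnatr_eq0 (gtn_eqF n_gt0).
rewrite EFinM lee_pmul// ?lee_fin ?powR_ge0//.
  apply: (@le_trans _ _ ((B * 2^-1 ^+ (j.+1 %/ m)) `^ gam)).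
    by apply: ge0_ler_powR; rewrite ?nnegrE// ?(ltW gam_gt0)// mulr_ge0 ?exprn_ge0// ltW.
  by rewrite powRM ?exprn_ge0 ?(ltW B0)// ler_wpM2l ?powR_ge0.
rewrite -poweR_EFin gt0_ler_poweR ?in_itv/= ?lee_fin ?leey ?andbT//.
  by apply: le_trans (mdist_le_diameter VX VZ); rewrite lee_fin.
exact: mdist_le_diameter.
Qed.

Let good j e y := ((thr j)%:E <= \sum_(k <oo | rep j k &&
  `[< cell (@mesh R n (dl j)) (X k) `<=` tube (dl j / 3) e y >]) (v k)%:E)%E.

(** Each value in [[0, D]] is the distance from [g (a e)] to some [g p] with [p] on the segment. A
    set [U k] contains [p], and its cell's representative supplies an interval around that value, so
    the pigeonhole over scales applies. *)
Let good_scale e : S e -> exists j, good j e (a e).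
Proof.
move=> Se.
have eta4 : 0 < eta 4 by exact: eta_gt0.
have /andP[dD DN] := D_bounds Se.
set D := mdist _ _ in dD DN.
have D0 : 0 < D by exact: lt_le_trans dD.
pose Q j k := rep j k && `[< cell (@mesh R n (dl j)) (X k) `<=` tube (dl j / 3) e (a e) >].
(* When [U k] is a single point, [xget] returns it. *)
have := @interval_cover_pigeonhole R D (fun k => mdist (g (a e)) (g (xget 0 (U k))))
  (fun k => mdist (g (a e)) (g (X k))) (fun k => eta 4 * v k) Q _ _
  (fun j => kap * q ^+ j.+1) D0 _ _.
have /andP[q0 q1] := q01.
have kap0 : 0 < kap by rewrite divr_gt0// subr_gt0.
case.
- by move=> k; rewrite mulr_ge0 ?mdist_ge0// ltW.
- move=> t tD.
  have [p ep ->] := qs_segment_onto eta_ge0 eta_le qs (S_sphere Se) (segK Se) DN eta_half tD.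
  have Kp : K p by exact: segK ep.
  have [k Pk Vk] : exists2 k, P k & V k (g p) by apply: V_cover; exists p.
  have Up : U k p by split => //; exists e.
  have [triv|ntk] := trivial_or_chosen k.
    by left; exists k; rewrite (triv _ _ (xgetPex 0 (ex_intro _ p Up)) Up).
  right; have [k' rk' ck'] := repP ntk.
  have [UX UZ near _] := ntP ntk.
  set j := J k in rk' ck' near *; exists j, k'.
  have /asboolP[ntk' Jk' _] := rk'.
  have [UX' UZ' near' far'] := ntP ntk'.
  rewrite Jk' in near' far'.
  have nm : n%:R * @mesh R n (dl j) = dl j / 6.
    by rewrite /mesh; field; rewrite pnatr_eq0 -lt0n n_gt0.
  have mesh0 : 0 < @mesh R n (dl j).
    by rewrite divr_gt0 ?mulr_gt0 ?ltr0n//; case/andP: (dl01 j).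
  split.
    (* The cell has diameter at most [dl j / 6], and [p] is within [dl j / 6] of [X k]: together
       [dl j / 3]. *)
    rewrite /Q rk'; apply/asboolP => y cy.
    apply: mem_tube ep _; apply: le_trans (metric_triangle _ (X k) _) _.
    have h1 := cell_mdist mesh0 cy ck'; rewrite nm in h1.
    by have h2 := near _ Up; lra.
  (* Likewise [p] is within [dl j / 3] of [X k'], four times the lower bound [dl j / 12] for the
     distance from [X k'] to [Z k']. *)
  have h : mdist (g (X k')) (g p) <= eta 4 * v k'.
    apply: (qs_le eta_le qs) => //.
    - by apply: segsK; case: UX'.
    - by apply: segsK; case: UZ'.
    - rewrite -mdist_gt0; apply: le_lt_trans far'; rewrite divr_ge0//.
      by case/andP: (dl01 j) => /ltW.
    have h1 := cell_mdist mesh0 (@mem_cell _ _ _ (X k')) ck'; rewrite nm in h1.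
    have h2 := near _ Up.
    by have h3 := metric_triangle (X k') (X k) p; lra.
  apply: le_trans h.
  have h1 := metric_triangle (g (a e)) (g (X k')) (g p).
  have h2 := metric_triangle (g (a e)) (g p) (g (X k')).
  rewrite (metric_sym (g p)) in h2.
  by rewrite ler_norml; apply/andP; split; lra.
- by move=> j; rewrite mulr_ge0 ?exprn_ge0// ltW.
- under eq_eseriesr do rewrite EFinM.
  rewrite nneseriesZl; last by move=> j _; rewrite lee_fin exprn_ge0// ltW.
  apply: (@le_lt_trans _ _ (kap%:E * (q / (1 - q))%:E)%E).
    by rewrite lee_wpmul2l ?lee_fin ?(ltW kap0)// geometric_nneseries_le// (ltW q0).
  have -> : (kap%:E * (q / (1 - q))%:E = (q / 2)%:E)%E.
    by rewrite -EFinM /kap; congr EFin; field; rewrite subr_eq0 gt_eqF.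
  by rewrite lte_fin; lra.
move=> j hj; exists j; rewrite /good /thr EFinM.
rewrite [leLHS]muleC lee_pdivrMl ?mulr_gt0//.
rewrite -nneseriesZl; last by move=> k _; rewrite lee_fin mdist_ge0.
apply: le_trans (le_trans hj _).
  by rewrite lee_fin ler_wpM2r// mulr_ge0 ?exprn_ge0// ltW.
apply: lee_nneseries => k _; first by rewrite lee_fin !mulr_ge0 ?mdist_ge0// ltW.
by rewrite -EFinM mulrA.
Qed.

(** At scale [j] the weak type inequality loses [q ^ (- 2 * n * (j + 1))], through [dl j] and
    [thr j], against the gain [q ^ ((2 * n + 1) * (j + 1))] of [v_sum]; a geometric series
    remains. *)
Lemma surface_le_of_cover : (surface_outer S <= (total * e0)%:E)%E.
Proof.
have eta4 : 0 < eta 4 by exact: eta_gt0.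
have /andP[q0 q1] := q01.
have kap0 : 0 < kap by rewrite divr_gt0// subr_gt0.
pose T j := S `&` [set e | exists y, good j e y].
pose c := @weak_const R n C * (d * kap / (2 * eta 4))^-1 ^+ n *
  (B `^ gam * 2 `^ gam) * e0.
have Tle j : (surface_outer (T j) <= (c * q ^+ j.+1)%:E)%E.
  have thr0 : 0 < thr j by rewrite divr_gt0 ?mulr_gt0 ?exprn_gt0 ?subr_gt0.
  have TS : T j `<=` usphere by move=> e [/S_sphere].
  have Tgood e : T j e -> exists y, good j e y by case.
  have := kakeya_weak_type n_gt0 maximal_bound (dl01 j) thr0 (fun k => mdist_ge0 _ _)
    (@rep_disjoint j) (v_sum j) TS Tgood.
  move=> /le_trans; apply; rewrite lee_fin le_eqVlt; apply/orP; left; apply/eqP.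
  rewrite dl_powR /c mulnC exprM /thr; set p := q ^+ j.+1.
  have p0 : 0 < p by rewrite exprn_gt0.
  have -> : p^-1 / (d * (kap * p) / (2 * eta 4)) =
      (d * kap / (2 * eta 4))^-1 * (p ^+ 2)^-1.
    by field; rewrite !gt_eqF.
  rewrite exprMn [_ ^+ (2 * n).+1]exprS exprM [((p ^+ 2)^-1) ^+ n]exprVn.
  have : (p ^+ 2) ^+ n != 0 by rewrite !expf_neq0 ?gt_eqF.
  move: ((p ^+ 2) ^+ n) ((d * kap / (2 * eta 4))^-1 ^+ n) => x y x0.
  by field.
have ST : S `<=` \bigcup_j T j.
  by move=> e Se; have [j gj] := good_scale Se; exists j => //; split => //; exists (a e).
apply: le_trans (le_outer_measure _ _ _ ST) _.
apply: le_trans (outer_measure_sigma_subadditive _ _) _.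
apply: le_trans (lee_nneseries _ (fun j _ => Tle j)) _.
  by move=> j _ _; exact: outer_measure_ge0.
under eq_eseriesr do rewrite EFinM.
rewrite nneseriesZl; last by move=> j _; rewrite lee_fin exprn_ge0// ltW.
have -> : total * e0 = c * (q / (1 - q)) by rewrite /total /c; ring.
rewrite [leRHS]EFinM; apply: lee_wpmul2l.
  by rewrite lee_fin mulr_ge0// ltW.
by apply: geometric_nneseries_le; rewrite q1 ltW.
Qed.

End one_cover.

Let total_ge0 : 0 <= total.
Proof.
have /andP[q0 q1] := q01.
by apply: mulr_ge0 => //; apply: divr_ge0; rewrite ?subr_ge0; exact: ltW.
Qed.

Lemma surface_null_of_bound : surface_outer S = 0%E.
Proof.
apply/eqP; rewrite eq_le outer_measure_ge0 andbT.
apply/lee_addgt0Pr => r r0; rewrite add0e.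
(* [total] does not depend on the cover, so a cover of small enough cost brings the bound below
   [r]. *)
have e0_gt0 : 0 < r / (total + 1) by rewrite divr_gt0// ltr_wpDl.
have D0 : 0 < d / (2 * eta 12 + 1).
  by rewrite divr_gt0// addr_gt0// mulr_gt0// eta_gt0.
have [P [V [Vsmall Vcover Vsum]]] := hausdorff_null_cover D0 e0_gt0 gK0.
apply: le_trans (surface_le_of_cover e0_gt0 Vsmall Vcover Vsum) _.
rewrite lee_fin mulrCA ler_piMr ?(ltW r0)//.
by rewrite ler_pdivrMr ?mul1r ?lerDl// ltr_wpDl.
Qed.

End null_directions.

(** * Conformal dimension *)

Section dimension_of_subsets.
Context {R : realType} {n : nat}.
Local Notation E := (euclid R n).
Variable K : set E.

Lemma diameter_le (T : metricType R) (U : set T) (r : R) :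
  (forall x y, U x -> U y -> mdist x y <= r) -> (diameter U <= r%:E)%E.
Proof. by move=> Ur; apply: ge_ereal_sup => _ [x Ux [y Uy <-]]; rewrite lee_fin Ur. Qed.

(* For [s > n], cutting a unit cell into [M ^ n] cells of mesh [1 / M] shows
   that it has [s]-dimensional content at most [(n / M) ^ s * M ^ n]. *)
Lemma hausdorff_unit_cell (s : R) (c : E) : n%:R < s ->
  hausdorff_outer s [set x : K | cell 1 c (val x)] = 0%E.
Proof.
move=> ns; set A := [set x : K | _].
have s0 : 0 < s by apply: le_lt_trans ns; exact: ler0n.
(* [f] records the position of the subcell in the unit cell along each axis. *)
pose U M (f : {ffun 'I_n -> 'I_M.+1}) : set K := A `&` [set x |
  forall i, Num.floor ((coord (val x) i - coord (corner 1 c) i) * M.+1%:R) = (f i : nat)%:Z].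
have diamU M f : (diameter (@U M f) <= (n%:R / M.+1%:R)%:E)%E.
  apply: diameter_le => x y [_ Ux] [_ Uy].
  have M0 : 0 < M.+1%:R :> R by rewrite ltr0n.
  apply: enorm_le_coord; first by rewrite invr_ge0.
  move=> i; rewrite coordD coordN.
  have /andP[x1 x2] := floor_itv ((coord (val x) i - coord (corner 1 c) i) * M.+1%:R).
  have /andP[y1 y2] := floor_itv ((coord (val y) i - coord (corner 1 c) i) * M.+1%:R).
  rewrite Ux in x1 x2; rewrite Uy in y1 y2.
  rewrite -[leRHS]mul1r ler_pdivlMr// -[X in _ * X]ger0_norm// -normrM ler_norml.
  by rewrite intrD in x2 y2; apply/andP; split; lra.
have Acover M : A `<=` \bigcup_(f in [set: {ffun 'I_n -> 'I_M.+1}]) U M f.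
  move=> x Ax; have M0 : 0 < M.+1%:R :> R by rewrite ltr0n.
  pose z i := Num.floor ((coord (val x) i - coord (corner 1 c) i) * M.+1%:R).
  have z01 i : 0 <= z i < M.+1%:Z.
    have : cell 1 c (val x) by [].
    rewrite cellE// => /(_ i)/andP[x1 x2].
    by rewrite floor_ge0 floor_lt_int !pmulrn mulr_ge0 ?subr_ge0//= gtr_pMl// ltrBlDl.
  exists [ffun i => inord `|z i|%N] => //; split => // i.
  have /andP[z0 z1] := z01 i.
  rewrite ffunE inordK; first by rewrite gez0_abs.
  by rewrite -ltz_nat gez0_abs.
have bound M d : n%:R / M.+1%:R <= d ->
    (hausdorff_content s d A <= ((n%:R / M.+1%:R) `^ s * M.+1%:R ^+ n)%:E)%E.
  move=> Md; pose fs := enum {ffun 'I_n -> 'I_M.+1}.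
  pose V k := U M (nth [ffun=> ord0] fs k).
  apply: le_trans (@cover_outer_le _ _ _ _ _ _ _ _ _ `I_(size fs) V _ _ _) _.
  - by move=> W _; exact: poweR_ge0.
  - exact: countableP.
  - by move=> k _; apply: le_trans (diamU M _) _; rewrite lee_fin.
  - move=> x /(Acover M)[f _ Uf]; exists (index f fs) => /=.
      by rewrite index_mem mem_enum.
    by rewrite /V nth_index ?mem_enum.
  apply: (@le_trans _ _ (\esum_(k in `I_(size fs)) ((n%:R / M.+1%:R) `^ s)%:E)%E).
    (* An empty piece has diameter [-oo], whose power is 0 because [s] is nonzero. *)
    apply: le_esum => k _; have [V0|/set0P[x Vx]] := eqVneq (V k) set0.
      rewrite V0 (_ : diameter set0 = -oo%E); last first.
        rewrite /diameter (_ : [set _ | _ in _ & _ in _] = set0) ?ereal_sup0//.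
        by apply/seteqP; split => // _ [x []].
      by rewrite poweRNyr ?gt_eqF// lee_fin powR_ge0.
    rewrite -poweR_EFin gt0_ler_poweR ?(ltW s0) ?in_itv/= ?leey ?andbT ?lee_fin ?divr_ge0//.
      by apply: le_trans (mdist_le_diameter Vx Vx); rewrite mdistxx.
    exact: diamU.
  rewrite esum_fset//.
  rewrite -(fsbig_ord _ _ (fun=> ((n%:R / M.+1%:R) `^ s)%:E)) sumEFin lee_fin.
  rewrite sumr_const card_ord -[leLHS]mulr_natr /fs -cardE.
  by rewrite card_ffun !card_ord natrX.
have le_eps d eps : 0 < d -> 0 < eps -> (hausdorff_content s d A <= eps%:E)%E.
  move=> d0 e0.
  (* The first bound on [M] makes the diameters at most [d], the second makes the total cost at most
     [eps]. *)
  pose L := Num.max (n%:R / d) ((n%:R `^ s / eps) `^ (s - n%:R)^-1).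
  pose M := Num.bound L.
  have sn0 : 0 < s - n%:R by rewrite subr_gt0.
  have LM : L <= M.+1%:R.
    apply: ltW; apply: lt_le_trans (_ : M%:R <= _); last by rewrite ler_nat.
    by apply: archi_boundP; rewrite le_max divr_ge0// ltW.
  have M0 : 0 < M.+1%:R :> R by rewrite ltr0n.
  move: LM; rewrite ge_max => /andP[L1 L2].
  apply: le_trans (bound M d _) _.
    by rewrite ler_pdivrMr// mulrC -ler_pdivrMr.
  have L3 : n%:R `^ s / eps <= M.+1%:R `^ (s - n%:R).
    have -> : n%:R `^ s / eps = ((n%:R `^ s / eps) `^ (s - n%:R)^-1) `^ (s - n%:R).
      by rewrite -powRrM mulVf ?gt_eqF// powRr1// divr_ge0 ?powR_ge0// ltW.
    by apply: ge0_ler_powR => //; rewrite ?nnegrE ?powR_ge0// ltW.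
  rewrite lee_fin powRM ?invr_ge0// -powR_inv1// -powRrM mulN1r -mulrA.
  rewrite -powR_mulrn// -powRD; last by rewrite pnatr_eq0 implybT.
  rewrite addrC -opprB powRN ler_pdivrMr ?powR_gt0//.
  by rewrite mulrC -ler_pdivrMr.
apply/eqP; rewrite eq_le hausdorff_outer_ge0 andbT.
apply: ge_ereal_sup => _ [d d0 <-].
by apply/lee_addgt0Pr => e e0; rewrite add0e; exact: le_eps.
Qed.

Lemma hausdorff_dim_le : (hausdorff_dim [set: K] <= n%:R%:E)%E.
Proof.
apply/lee_addgt0Pr => e e0; rewrite -EFinD; apply: ereal_inf_lbound.
exists (n%:R + e) => //; split; first by rewrite addr_ge0// ltW.
(* An enumeration of the integer points; numbers that encode none are sent to 0. *)
pose c (k : nat) : E := if @unpickle {ffun 'I_n -> int} k is Some f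
  then \row_i (f i)%:~R else 0.
have KU : [set: K] `<=` \bigcup_k [set x : K | cell 1 (c k) (val x)].
  move=> x _; exists (pickle [ffun i => Num.floor (coord (val x) i)]) => // i.
  by rewrite /c pickleK coord_row ffunE !divr1 intrKfloor.
apply/eqP; rewrite eq_le outer_measure_ge0 andbT.
apply: le_trans (le_outer_measure _ _ _ KU) _.
apply: le_trans (outer_measure_sigma_subadditive _ _) _.
rewrite eseries0// => k _ _; apply: hausdorff_unit_cell.
by rewrite ltrDl.
Qed.

Lemma conformal_dim_le : (conformal_dim K <= n%:R%:E)%E.
Proof.
apply: le_trans hausdorff_dim_le; apply: ereal_inf_lbound.
have homeo_id (T : topologicalType) (A : set T) : homeomorphism A A id.
  split; first by split=> [x|x y|x Ax] //; exists x.
    by apply: continuous_subspaceT => x; exact: cvg_id.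
  by exists id => //; apply: continuous_subspaceT => x; exact: cvg_id.
exists K, id; split; last by rewrite image_id.
split; first exact: homeo_id.
by exists id; split => //; exact: homeo_id.
Qed.

End dimension_of_subsets.

(** * The lower bound for Kakeya sets *)

Section conformal_dimension_of_kakeya_sets.
Context {R : realType} {n : nat}.
Local Notation E := (euclid R n).

(** Injectivity of [f] allows clearing the denominator; [m] exists because the increasing bijection
    [eta] takes the value [1 / 2] at a positive point. *)
Lemma quasisymmetric_distortion (X Y : metricType R) (f : X -> Y) : quasisymmetric f ->
  injective f /\ exists eta : R -> R,
  [/\ forall t, 0 < t -> 0 < eta t,
      forall t, 0 <= t -> 0 <= eta t,
      forall t u, 0 <= t -> t <= u -> eta t <= eta u,
      exists2 m, (0 < m)%N & eta (2^-1 ^+ m) <= 2^-1 &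
      forall x y z, x != z ->
        mdist (f x) (f y) <= eta (mdist x y / mdist x z) * mdist (f x) (f z)].
Proof.
move=> [[[_ finj _] _ _] [eta [[[eta_fun _ eta_surj] _ _] eta_lt eta_qs]]].
have f_inj : injective f by move=> x y; apply: finj; rewrite inE.
split=> //; exists eta.
have eta_ge0 t : 0 <= t -> 0 <= eta t.
  move=> t0; have /= := eta_fun t; rewrite !in_itv/= !andbT; exact.
have eta_mono t u : 0 <= t -> t < u -> eta t < eta u.
  move=> t0 tu; apply: eta_lt => //; rewrite in_itv/= andbT//.
  exact: le_trans (ltW tu).
have eta_gt0 t : 0 < t -> 0 < eta t.
  move=> t0; apply: le_lt_trans (eta_mono _ _ (lexx 0) t0); exact: eta_ge0.
have eta_le t u : 0 <= t -> t <= u -> eta t <= eta u.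
  move=> t0; rewrite le_eqVlt => /predU1P[->//|tu]; exact/ltW/eta_mono.
split=> //.
  have /eta_surj[l /=] : (`[0, +oo[%classic : set R) 2^-1 by rewrite /= in_itv/= andbT invr_ge0.
  rewrite in_itv/= andbT => l0 el.
  (* At [l = 0] the least value of [eta] would be [1 / 2], although 0 is also a value. *)
  have l_gt0 : 0 < l.
    rewrite lt_neqAle l0 andbT; apply/negP => /eqP l00.
    have /eta_surj[l' /=] : (`[0, +oo[%classic : set R) 0 by rewrite /= in_itv/= lexx.
    rewrite in_itv/= andbT => l'0 el'.
    have := eta_le _ _ (lexx 0) l'0; rewrite el' l00 el; lra.
  exists (Num.bound l^-1).+1 => //; rewrite -[leRHS]el; apply: eta_le.
    by rewrite exprn_ge0.
  rewrite exprVn -[leRHS]invrK lef_pV2 ?posrE ?exprn_gt0 ?invr_gt0//.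
  by apply: ltW; apply: upper_nthrootP.
move=> x y z xz; rewrite -ler_pdivrMr; first exact: eta_qs.
by rewrite mdist_gt0; apply: contra xz => /eqP/f_inj ->.
Qed.

Lemma conformal_dim_ge (K : set E) : (0 < n)%N -> kakeya_maximal_conjecture R n ->
  kakeya_set K -> (n%:R%:E <= conformal_dim K)%E.
Proof.
move=> n0 kakeya [S [S1 S0 SK]].
apply: le_ereal_inf_tmp => _ [Y [f [qf ->]]].
rewrite leNgt; apply/negP => /ereal_inf_lt[_ [s [s0 fs0] <-]]; rewrite lte_fin => sn.
have [f_inj [eta [eta_gt0 eta_ge0 eta_le [m m0 eta_m] qs]]] := quasisymmetric_distortion qf.
have [a aK] : {a : E -> E & forall e, S e -> unit_segment e (a e) `<=` K}.
  apply: (@choice _ _ (fun e x => S e -> unit_segment e x `<=` K)) => e.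
  by have [/SK[x xK]|nSe] := pselect (S e); [exists x|exists 0 => /nSe].
have a0K e : S e -> K (a e).
  by move=> Se; apply: (aK _ Se); exists 0; rewrite /= ?in_itv/= ?lexx ?ler01// scale0r addr0.
have a1K e : S e -> K (a e + e).
  by move=> Se; apply: (aK _ Se); exists 1; rewrite /= ?in_itv/= ?lexx ?ler01// scale1r.
have [e1 Se1] : exists e, S e.
  apply/not_existsP => nS; move: S0; rewrite (_ : S = set0) ?outer_measure0 ?ltxx//.
  by apply/seteqP; split => // e /nS.
pose x0 : K := SigSub (mem_set (a0K _ Se1)).
(* [f] is defined on the subtype only; outside [K] it is extended by its value at [x0]. *)
pose g (x : E) : Y := f (insubd x0 x).
have gE x (Kx : K x) : g x = f (SigSub (mem_set Kx)).
  rewrite /g; congr f; apply: val_inj; rewrite val_insubd/=.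
  by rewrite (mem_set Kx).
have qs_g x y z : K x -> K y -> K z -> x != z ->
    mdist (g x) (g y) <= eta (mdist x y / mdist x z) * mdist (g x) (g z).
  move=> Kx Ky Kz xz; rewrite (gE _ Kx) (gE _ Ky) (gE _ Kz).
  exact: (qs (SigSub (mem_set Kx)) (SigSub (mem_set Ky)) (SigSub (mem_set Kz))).
have gK0 : hausdorff_outer s (g @` K) = 0%E.
  apply/eqP; rewrite eq_le hausdorff_outer_ge0 andbT -fs0.
  by apply: le_hausdorff_outer => _ [x Kx <-]; exists (insubd x0 x).
have s_ltn : s < n%:R by exact: sn.
have eps0 : 0 < (n%:R - s) / ((2 * n).+1%:R * m%:R).
  by rewrite divr_gt0 ?subr_gt0// mulr_gt0 ?ltr0n.
have [C hC] := kakeya _ eps0.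
pose D e := mdist (g (a e)) (g (a e + e)).
(* The estimates need two-sided bounds on [D e]. Injectivity of [f] gives [D e > 0], so these
   countably many sets exhaust [S], and each of them is null. *)
pose SN N := S `&` [set e | N.+1%:R^-1 <= D e <= N.+1%:R].
have SN0 N : surface_outer (SN N) = 0%E.
  apply: (surface_null_of_bound n0 eta_gt0 eta_ge0 eta_le m0 eta_m qs_g s0 s_ltn gK0
    (a := a) (N := N.+1%:R) (d := N.+1%:R^-1) _ _ _ _ _ hC) => //.
  - by move=> e [/S1].
  - by move=> e [/aK].
  - by move=> e [].
have SSN : S `<=` \bigcup_N SN N.
  move=> e Se; have D0 : 0 < D e.
    rewrite /D mdist_gt0 (gE _ (a0K _ Se)) (gE _ (a1K _ Se)).
    apply/eqP => /f_inj/(congr1 val)/= /eqP.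
    rewrite -subr_eq0 opprD addrA subrr sub0r oppr_eq0 => /eqP e0.
    by have := S1 _ Se; rewrite /usphere/= e0 enorm0 => /esym/eqP; rewrite oner_eq0.
  exists (maxn (Num.bound (D e)) (Num.bound (D e)^-1)) => //; split => //=.
  set M := maxn _ _.
  have bM x : 0 <= x -> (Num.bound x <= M)%N -> x <= M.+1%:R.
    move=> x0' xM; apply/ltW; apply: lt_le_trans (archi_boundP x0') _.
    by rewrite ler_nat ltnW.
  apply/andP; split; last by apply: bM; [exact: ltW|exact: leq_maxl].
  rewrite -[leRHS]invrK lef_pV2 ?posrE ?invr_gt0//.
  by apply: bM; [rewrite invr_ge0 ltW|exact: leq_maxr].
move: S0; rewrite ltNge => /negP; apply.
apply: le_trans (le_outer_measure _ _ _ SSN) _.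
apply: le_trans (outer_measure_sigma_subadditive _ _) _.
by rewrite eseries0.
Qed.

End conformal_dimension_of_kakeya_sets.

Theorem corollary1p8 (R : realType) (n : nat) (n_ge2 : (2 <= n)%N)
    (kakeya_maximal_conj : kakeya_maximal_conjecture R n)
    (K : set (euclid R n)) (kakeyaK : kakeya_set K) :
  conformal_dim K = (n%:R)%:E.
Proof.
apply/eqP; rewrite eq_le conformal_dim_le/=.
by apply: conformal_dim_ge => //; exact: leq_trans n_ge2.
Qed.
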